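(* Let $T$ be the Chacon$_{(3)}$ transformation on $(X,\mathcal B,\mu)$ with Koopman operator $\hat T$, let $(h_n)$ be the sequence of tower heights, $h_0=1$, $h_{n+1}=3h_n+1$, and for $m\in\mathbb N$, $m\ge 1$, let $\rho_m$ be the distribution of the cocycle sum $\phi_0^{(m)}$ on the group of $3$-adic integers (a finitely supported probability measure on $\mathbb Z$). Then for every $m\in\mathbb N$, $m\geq 1$, the sequence $\hat T^{-mh_n}$ converges weakly as $n\to\infty$ to a polynomial in $\hat T$, namely $$\lim_{n\to\infty}\hat T^{-mh_n}=\int_{\mathbb Z}\hat T^k\,d\rho_m(k)=\sum_{k\in\mathbb Z}\rho_m(\{k\})\,\hat T^k .$$
   Context: Chacon$_{(3)}$ transformation: consider the substitution $0\mapsto 0010$, $1\mapsto 1$ on the alphabet $\{0,1\}$. Put $w_0=0$ and let $w_{n+1}$ be obtained from $w_n$ by applying the substitution to each letter (so $w_1=0010$, $w_2=0010001010010$, and so on). Each $w_n$ is a prefix of $w_{n+1}$; let $w_\infty$ be the one-sided infinite word having all $w_n$ as prefixes. Let $X\subset\{0,1\}^{\mathbb Z}$ be the closed shift-invariant set of two-sided sequences all of whose finite subwords occur in $w_\infty$, $\mathcal B$ its Borel $\sigma$-algebra, $T$ the left shift $(Tx)_j=x_{j+1}$, and $\mu$ the $T$-invariant probability measure for which, for every finite word $w$ of length $\ell$, $\mu(\{x\in X: x_0=w(0),\dots,x_{\ell-1}=w(\ell-1)\})$ is the asymptotic frequency of occurrences of $w$ in $w_\infty$. The number $h_n$ is the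 length of $w_n$, equivalently the height of the $n$-th tower in the standard cutting-and-stacking (rank one) construction of $T$, in which at each step the tower is cut into three equal columns, one extra level is put on top of the middle column, and the columns are stacked. Koopman operator: $\hat T$ is the unitary operator on $L^2(X,\mu)$ given by $(\hat T f)(x)=f(Tx)$. Weak convergence: bounded operators $A_j$ on a Hilbert space $H$ converge weakly to $A$ if $\langle A_jf,g\rangle\to\langle Af,g\rangle$ for all $f,g\in H$. Cocycle: let $\Gamma=\mathbb Z_{3}$ be the compact group of $3$-adic integers, identified with sequences $y=(y_1,y_2,\dots)$, $y_k\in\{0,1,2\}$ ($y_1$ being the least significant digit, i.e. $y$ represents $\sum_{k\ge1}y_k3^{k-1}$), with Haar probability measure, and let $S:\Gamma\to\Gamma$, $Sy=y+1$ (adding machine). For $y\in\Gamma$ not equal to the constant sequence $(2,2,2,\dots)$, let $\phi_0(y)=0$ if the first digit of $y$ different from $2$ is $0$, and $\phi_0(y)=1$ if the first digit of $y$ different from $2$ is $1$ (the value at $(2,2,2,\dots)$, a null set, is irrelevant; put $\phi_0=0$ there). For $m\ge1$ put $$\phi_0^{(m)}(y)=\phi_0(y)+\phi_0(Sy)+\dots+\phi_0(S^{m-1}y),$$ and let $\rho_m$ be the image of the Haar probability measure on $\Gamma$ under $\phi_0^{(m)}$. *)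

(* Defs.v *)
From HB Require Import structures.
From mathcomp Require Import all_boot all_order all_algebra.
From mathcomp Require Import all_classical all_reals all_analysis.
From mathcomp Require Import measurable_realfun complex zify.
Set Implicit Arguments.
Unset Strict Implicit.
Unset Printing Implicit Defensive.
Import Order.TTheory GRing.Theory Num.Theory.
Import numFieldNormedType.Exports.
Local Open Scope classical_set_scope.
Local Open Scope complex_scope.
Local Open Scope ring_scope.

(* The letters 0 and 1 are false and true. *)

Definition subst_letter (b : bool) : seq bool :=
  if b then [:: true] else [:: false; false; true; false].

Definition chacon_word (n : nat) : seq bool :=
  iter n (fun w => flatten [seq subst_letter b | b <- w]) [:: false].

Fixpoint tower_height (n : nat) : nat :=
  if n is k.+1 then (3 * tower_height k + 1)%N else 1%N.

(* The letter of index i is already present in chacon_word i, whose length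
   exceeds i; chacon_inf_prefix shows that this is the common limit. *)
Definition chacon_inf (i : nat) : bool := nth false (chacon_word i) i.

Lemma chacon_wordS n : chacon_word n.+1 =
  chacon_word n ++ chacon_word n ++ true :: chacon_word n.
Proof.
elim: n => [//|n IHn].
rewrite {1}/chacon_word iterS -/(chacon_word n.+1) {1}IHn.
rewrite !map_cat !flatten_cat /=.
by rewrite -/(chacon_word n.+1).
Qed.

Lemma size_chacon_word n : size (chacon_word n) = tower_height n.
Proof.
elim: n => [//|n IHn]; rewrite chacon_wordS !size_cat /= !IHn.
by rewrite addnS addn1 !mulSn mul0n addn0 addnS.
Qed.

Lemma tower_height_gt n : (n < tower_height n)%N.
Proof.
elim: n => [//|n IHn] /=; rewrite addn1 ltnS.
by apply: (leq_trans IHn); rewrite leq_pmull.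
Qed.

Lemma chacon_word_mono m n i : (m <= n)%N -> (i < tower_height m)%N ->
  nth false (chacon_word n) i = nth false (chacon_word m) i.
Proof.
move=> /subnK <- im; elim: (n - m)%N => [//|k IHk].
rewrite addSn chacon_wordS nth_cat size_chacon_word ifT//.
apply: (leq_trans im); elim: k {IHk} => [//|k /leq_trans-> //].
by rewrite addSn /= addn1 ltnW // ltnS leq_pmull.
Qed.

Lemma chacon_infE n i : (i < tower_height n)%N ->
  chacon_inf i = nth false (chacon_word n) i.
Proof.
move=> iN; rewrite /chacon_inf; case: (leqP n i) => ni.
  exact: chacon_word_mono.
by rewrite (chacon_word_mono (ltnW ni)) // tower_height_gt.
Qed.

Lemma chacon_inf_prefix n : mkseq chacon_inf (tower_height n) = chacon_word n.
Proof.
apply: (@eq_from_nth _ false); rewrite size_mkseq ?size_chacon_word// => i iN.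
by rewrite nth_mkseq// (chacon_infE iN).
Qed.

Definition occurs_at (u : seq bool) (i : nat) : bool :=
  mkseq (fun j => chacon_inf (i + j)%N) (size u) == u.

Definition full_shift : Type := prod_topology (fun _ : int => bool).
HB.instance Definition _ := Topological.copy full_shift
  (prod_topology (fun _ : int => bool)).

Definition subword (x : full_shift) (i : int) (l : nat) : seq bool :=
  mkseq (fun j => x (i + j%:Z)) l.

Definition chacon_set : set full_shift :=
  [set x | forall (i : int) (l : nat), exists k, occurs_at (subword x i l) k].

Definition shift_by (k : int) (x : full_shift) : full_shift :=
  fun j => x (j + k).

Lemma shift_by_chacon k x : chacon_set x -> chacon_set (shift_by k x).
Proof.
move=> xX i l; have [n] := xX (i + k) l; exists n.
rewrite (_ : subword _ _ _ = subword x (i + k) l)//.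
by apply: eq_mkseq => j; rewrite /shift_by addrAC.
Qed.

(* A point of X: the origin sits in the middle copy of w_n inside w_(n+1) at
   every stage.  It is needed because measurable types are pointed. *)
Fixpoint origin (n : nat) : nat :=
  if n is k.+1 then (tower_height k + origin k)%N else 0%N.

Definition chacon_point : full_shift :=
  fun i => chacon_inf (absz ((origin `|i|%N)%:Z + i)).

Lemma origin_ge n : (n <= origin n)%N.
Proof.
elim: n => [//|n IHn] /=.
by rewrite -add1n leq_add// (leq_ltn_trans _ (tower_height_gt n)).
Qed.

Lemma origin_lt n : (origin n + n < tower_height n)%N.
Proof. by elim: n => [//|n IHn] /=; have := tower_height_gt n; lia. Qed.

Lemma origin_ge0 n (i : int) : (`|i| <= n)%N ->
  ((absz ((origin n)%:Z + i)))%:Z = (origin n)%:Z + i.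
Proof.
move=> i_n; rewrite gez0_abs// -lerBlDr sub0r.
apply: (@le_trans _ _ (absz i)%:Z); first by rewrite abszE -normrN ler_norm.
by rewrite lez_nat (leq_trans i_n)// origin_ge.
Qed.

Lemma chacon_pointE n (i : int) : (`|i| <= n)%N ->
  chacon_point i = chacon_inf (absz ((origin n)%:Z + i)).
Proof.
move=> /subnK <-; elim: (n - _)%N => [//|k ->]; rewrite addSn.
set m := (k + _)%N; rewrite /=.
have im : (`|i| <= m)%N by rewrite leq_addl.
rewrite PoszD -addrA -(origin_ge0 im) -PoszD absz_nat.
have lt : (absz ((origin m)%:Z + i)%R < tower_height m)%N.
  apply: leq_ltn_trans (origin_lt m).
  rewrite -lez_nat (origin_ge0 im) PoszD lerD2l.
  apply: (@le_trans _ _ (absz i)%:Z); last by rewrite lez_nat.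
  by rewrite abszE ler_norm.
rewrite (chacon_infE lt) (@chacon_infE m.+1); last by rewrite /=; lia.
rewrite chacon_wordS nth_cat size_chacon_word ltnNge leq_addr /= addKn.
by rewrite nth_cat size_chacon_word lt.
Qed.

Lemma chacon_point_in : chacon_set chacon_point.
Proof.
move=> i l; pose n := (`|i| + l)%N; exists (absz ((origin n)%:Z + i)).
rewrite /occurs_at size_mkseq; apply/eqP/eq_in_map => j.
rewrite mem_iota add0n => /andP[_ jl].
have i_n : (`|i| <= n)%N by rewrite leq_addr.
have ij_n : (absz (i + j%:Z)%R <= n)%N.
  rewrite -lez_nat abszE (le_trans (ler_normD _ _))// /n PoszD.
  by rewrite -abszE lerD2l ger0_norm// lez_nat ltnW.
rewrite (chacon_pointE ij_n); congr chacon_inf; apply/eqP.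
by rewrite -eqz_nat PoszD (origin_ge0 i_n) (origin_ge0 ij_n) addrA.
Qed.

Definition chacon_space : Type := set_type chacon_set.
HB.instance Definition _ := Topological.copy chacon_space (set_type chacon_set).
HB.instance Definition _ := isPointed.Build chacon_space
  (exist _ chacon_point (mem_set chacon_point_in)).
HB.instance Definition _ := Measurable.copy chacon_space
  (g_sigma_algebraType (@open chacon_space)).

Definition shift_X (k : int) (x : chacon_space) : chacon_space :=
  exist _ (shift_by k (val x)) (mem_set (shift_by_chacon k (set_valP x))).

Definition chacon_T : chacon_space -> chacon_space := shift_X 1.
Definition chacon_Tinv : chacon_space -> chacon_space := shift_X (-1).

Lemma locally_constant_continuous (T : topologicalType)
    (I : choiceType) (U : I -> topologicalType) (f : T -> prod_topology U) :
  (forall i x, nbhs x [set z | f z i = f x i]) -> continuous f.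
Proof.
move=> cf x; apply/cvg_sup => i; move: x.
apply/(@continuousP _ (initial_topology (fun g : forall i, U i => g i))).
move=> A [B _ <-]; rewrite openE => x /= Bx; rewrite /interior.
by apply: filterS (cf i x) => z /= zx; rewrite zx.
Qed.

Lemma shift_by_continuous k : continuous (shift_by k).
Proof.
apply: (@locally_constant_continuous full_shift int (fun=> bool)) => j x.
apply: (@proj_continuous _ (fun=> bool) (j + k) x [set x (j + k)]).
exact: discrete_set1.
Qed.

Lemma measurable_shift_X k : measurable_fun setT (shift_X k).
Proof.
apply: (measurability (@open chacon_space)) => // _ [A [B oB <-] <-].
rewrite setTI; apply: sub_sigma_algebra; exists (shift_by k @^-1` B) => //.
by apply: open_comp => // x _; exact: shift_by_continuous.
Qed.

Lemma shift_XK k : cancel (shift_X k) (shift_X (- k)).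
Proof.
by move=> x; apply: val_inj; apply: funext => j /=; rewrite /shift_by subrK.
Qed.

Lemma chacon_TK : cancel chacon_T chacon_Tinv.
Proof. exact: shift_XK. Qed.

Lemma chacon_TinvK : cancel chacon_Tinv chacon_T.
Proof. exact: shift_XK. Qed.

Definition cylinder (u : seq bool) : set chacon_space :=
  [set x | subword (val x) 0 (size u) = u].

Section measure.
Context {R : realType}.

(* The first clause is invariance; the second equates the measure of every
   cylinder with an asymptotic frequency (which is required to exist).  It
   determines mu, the cylinders being a pi-system generating the Borel sets. *)
Definition chacon_measure (mu : probability chacon_space R) : Prop :=
  (forall A, measurable A -> mu (chacon_T @^-1` A) = mu A) /\
  (forall u : seq bool,
    (fun N : nat => (\sum_(i < N) occurs_at u i)%N%:R / N%:R) @ \oo -->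
    fine (mu (cylinder u))).

End measure.

(* Digit k (counted from 0, least significant first) has weight 3 ^ k. *)
Definition adic3 : Type := prod_topology (fun _ : nat => discrete_topology 'I_3).
HB.instance Definition _ := Topological.copy adic3
  (prod_topology (fun _ : nat => discrete_topology 'I_3)).
HB.instance Definition _ := isPointed.Build adic3 (fun=> ord0).
HB.instance Definition _ := Measurable.copy adic3
  (g_sigma_algebraType (@open adic3)).

Definition digit (y : adic3) (k : nat) : nat := (y k : 'I_3).

Definition adic3_trunc (y : adic3) (n : nat) : nat :=
  (\sum_(k < n) digit y k * 3 ^ k)%N.

(* Addition with carry; adic3_trunc_add is the compatibility with the
   projections to Z/3^n. *)
Definition adic3_add (x y : adic3) : adic3 :=
  fun k => inZp ((adic3_trunc x k.+1 + adic3_trunc y k.+1) %/ 3 ^ k).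

Definition adic3_one : adic3 := fun k => inZp (k == 0%N).

Lemma adic3_truncS y n :
  adic3_trunc y n.+1 = (adic3_trunc y n + digit y n * 3 ^ n)%N.
Proof. by rewrite /adic3_trunc big_ord_recr. Qed.

Lemma adic3_trunc_add x y n : adic3_trunc (adic3_add x y) n =
  ((adic3_trunc x n + adic3_trunc y n) %% 3 ^ n)%N.
Proof.
elim: n => [|n IHn]; first by rewrite modn1 /adic3_trunc big_ord0.
rewrite adic3_truncS IHn.
set N := (adic3_trunc x n.+1 + _)%N.
rewrite (_ : digit _ n = (N %/ 3 ^ n) %% 3)%N//.
have <- : (N %% 3 ^ n = (adic3_trunc x n + adic3_trunc y n) %% 3 ^ n)%N.
  rewrite /N !adic3_truncS addnACA -mulnDl.
  by rewrite addnC modnMDl.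
have -> : (N %% 3 ^ n = (N %% 3 ^ n.+1) %% 3 ^ n)%N.
  by rewrite modn_dvdm// dvdn_exp2l.
have -> : ((N %/ 3 ^ n) %% 3 = (N %% 3 ^ n.+1) %/ 3 ^ n)%N.
  by rewrite modn_divl -expnS.
by rewrite addnC -divn_eq.
Qed.

Definition odometer (y : adic3) : adic3 := adic3_add y adic3_one.

(* Translation invariance determines the Haar probability measure. *)
Definition haar_probability {R : realType} (nu : probability adic3 R) : Prop :=
  forall (a : adic3) (A : set adic3), measurable A ->
    nu (adic3_add a @^-1` A) = nu A.

Definition first_non2_is1 : set adic3 :=
  [set y | exists n, (forall i, (i < n)%N -> digit y i = 2) /\ digit y n = 1].

(* At the constant sequence 2, 2, ... the value is 0. *)
Definition phi0 (y : adic3) : int := (`[< first_non2_is1 y >] : nat)%:Z.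

Definition phi0_sum (m : nat) (y : adic3) : int :=
  \sum_(i < m) phi0 (iter i odometer y).

HB.instance Definition _ := isPointed.Build int 0.
HB.instance Definition _ := @isMeasurable.Build default_measure_display
  int discrete_measurable discrete_measurable0
  discrete_measurableC discrete_measurableU.

Lemma nbhs_digits (y : adic3) n :
  nbhs y [set z | forall i, (i < n)%N -> z i = y i].
Proof.
elim: n => [|n IHn]; first by apply: filterS filterT.
have yn : nbhs y ((fun z : adic3 => z n) @^-1` [set y n]).
  apply: (@proj_continuous _ (fun=> discrete_topology 'I_3) n y).
  exact: discrete_set1.
apply: filterS (filterI IHn yn) => z [/= zy zn] i.
by rewrite ltnS leq_eqVlt => /predU1P[->//|/zy].
Qed.

Lemma open_first_non2_is1 : open first_non2_is1.
Proof.
rewrite openE => y /= [n [y2 y1]]; rewrite /interior.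
apply: filterS (nbhs_digits y n.+1) => z /= zy; exists n.
by split=> [i i_n|]; rewrite /digit zy//; [exact: y2|exact: ltnW].
Qed.

Lemma odometer_continuous : continuous odometer.
Proof.
apply: (@locally_constant_continuous adic3 nat
  (fun=> discrete_topology 'I_3)) => i y.
apply: filterS (nbhs_digits y i.+1) => z zy.
by congr (inZp ((_ + _) %/ _)); apply: eq_bigr => k _; rewrite /digit zy.
Qed.

Lemma measurable_odometer : measurable_fun setT odometer.
Proof.
apply: (measurability (@open adic3)) => // _ [A oA <-]; rewrite setTI.
apply: sub_sigma_algebra; apply: open_comp => // y _.
exact: odometer_continuous.
Qed.

Lemma measurable_phi0 : measurable_fun setT phi0.
Proof.
have mF : measurable first_non2_is1.
  by apply: sub_sigma_algebra; exact: open_first_non2_is1.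
have mc (P : Prop) : measurable [set y : adic3 | P].
  have [p|np] := pselect P.
    suff -> : [set _ : adic3 | P] = setT by exact: measurableT.
    by apply/seteqP; split.
  suff -> : [set _ : adic3 | P] = set0 by exact: measurable0.
  by apply/seteqP; split=> [y /np|y []].
move=> _ A _; rewrite setTI (_ : _ @^-1` A =
    (first_non2_is1 `&` [set _ | A 1]) `|` (~` first_non2_is1 `&` [set _ | A 0])).
  by apply: measurableU; apply: measurableI => //; exact: measurableC.
apply/seteqP; split=> y; rewrite /= /phi0; case: asboolP => yF /=.
- by left.
- by right.
- by case=> [[]|[]].
- by case=> [[]|[]].
Qed.

Lemma measurable_intD d (T : measurableType d) (f g : T -> int) :
  measurable_fun setT f -> measurable_fun setT g ->
  measurable_fun setT (fun y => f y + g y).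
Proof.
move=> mf mg _ A _; rewrite setTI.
rewrite (_ : _ @^-1` A = \bigcup_k (f @^-1` [set k] `&`
    g @^-1` [set l | A (k + l)])); last first.
  apply/seteqP; split=> y /=; first by move=> Ay; exists (f y).
  by case=> k _ /= [->].
apply: countable_bigcupT_measurable => // k; apply: measurableI.
  by rewrite -[X in measurable X]setTI; exact: mf.
by rewrite -[X in measurable X]setTI; exact: mg.
Qed.

Lemma measurable_phi0_sum m : measurable_fun setT (phi0_sum m).
Proof.
elim: m => [|m IHm].
  rewrite (_ : phi0_sum 0 = cst 0)//.
  by apply/funext => y; rewrite /phi0_sum big_ord0.
rewrite (_ : phi0_sum m.+1 =
    fun y => phi0_sum m y + phi0 (iter m odometer y)); last first.
  by apply/funext => y; rewrite /phi0_sum big_ord_recr.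
apply: measurable_intD => //; apply: (measurableT_comp measurable_phi0).
elim: m {IHm} => [|m IHm]; first exact: measurable_id.
exact: (measurableT_comp measurable_odometer).
Qed.

HB.instance Definition _ m :=
  isMeasurableFun.Build _ _ _ _ (phi0_sum m) (measurable_phi0_sum m).

Definition rho {R : realType} (nu : probability adic3 R) (m : nat) :
  probability int R := distribution nu (phi0_sum m).

Lemma rho_finite_support (R : realType) (nu : probability adic3 R) m :
  finite_set [set k : int | rho nu m [set k] != 0%E].
Proof.
apply: (@sub_finite_set _ _ (Posz @` `I_m.+1)); last exact: finite_image.
move=> k /=; apply: contra_neqP => kI.
rewrite /rho /= /distribution /pushforward (_ : _ @^-1` _ = set0) ?measure0//.
rewrite -subset0 => y /= yk; apply: kI; rewrite -yk /phi0_sum.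
exists (\sum_(i < m) `[< first_non2_is1 (iter i odometer y) >])%N.
  rewrite /= ltnS -[leqRHS]card_ord -sum1_card leq_sum// => i _.
  exact: leq_b1.
by rewrite (big_morph Posz PoszD (erefl _)).
Qed.

(* Elements of complex L^2 are represented by square-integrable functions:
   inner products do not see null sets, and composition with the shift preserves
   a.e. equality since the measure is shift-invariant. *)

Definition cintegral (d : measure_display) (T : measurableType d)
    (R : realType) (mu : {measure set T -> \bar R}) (f : T -> R[i]) : R[i] :=
  (\int[mu]_x complex.Re (f x)) +i* (\int[mu]_x complex.Im (f x)).

Section L2.
Context {d : measure_display} {T : measurableType d} {R : realType}.
Implicit Types (f g : T -> R[i]).

Definition L2 (mu : {measure set T -> \bar R}) f : Prop :=
  [/\ measurable_fun setT (@complex.Re R \o f),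
      measurable_fun setT (@complex.Im R \o f) &
      (\int[mu]_x ((ComplexField.Normc.normc (f x)) ^+ 2)%:E < +oo)%E].

Definition inner (mu : {measure set T -> \bar R}) f g : R[i] :=
  cintegral mu (fun x => f x * (g x)^*%C).

Definition weak_cvg (mu : {measure set T -> \bar R})
    (A : nat -> (T -> R[i]) -> (T -> R[i]))
    (B : (T -> R[i]) -> (T -> R[i])) : Prop :=
  forall f g, L2 mu f -> L2 mu g ->
    (fun n => inner mu (A n f) g : R[i]^o) @ \oo --> (inner mu (B f) g : R[i]^o).

(* B is the weak operator integral of k |-> A k against lambda. *)
Definition weak_integral (mu : {measure set T -> \bar R})
    (lambda : {measure set int -> \bar R})
    (A : int -> (T -> R[i]) -> (T -> R[i]))
    (B : (T -> R[i]) -> (T -> R[i])) : Prop :=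
  forall f g, L2 mu f -> L2 mu g ->
    inner mu (B f) g =
    cintegral lambda (fun k => inner mu (A k f) g).

End L2.

Section koopman.
Context {R : realType}.
Implicit Types (f : chacon_space -> R[i]).

Definition koopman f : chacon_space -> R[i] := f \o chacon_T.

Definition koopman_inv f : chacon_space -> R[i] := f \o chacon_Tinv.

Lemma koopmanK : cancel koopman koopman_inv.
Proof.
by move=> f; apply/funext => x; rewrite /koopman_inv /koopman /= chacon_TinvK.
Qed.

Lemma koopman_invK : cancel koopman_inv koopman.
Proof.
by move=> f; apply/funext => x; rewrite /koopman_inv /koopman /= chacon_TK.
Qed.

Section unitary.
Context (mu : probability chacon_space R) (mu_chacon : chacon_measure mu).
Local Open Scope ereal_scope.

Lemma ge0_integral_chacon_T (F : chacon_space -> \bar R) :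
  measurable_fun setT F -> (forall x, 0 <= F x) ->
  \int[mu]_x F (chacon_T x) = \int[mu]_x F x.
Proof.
move=> mF F0; have mT := measurable_shift_X 1.
rewrite -[RHS](@eq_measure_integral _ _ _ setT _
    (pushforward mu chacon_T : {measure set _ -> \bar R})) => [|A mA _].
  by rewrite ge0_integral_pushforward.
by case: mu_chacon => + _; exact.
Qed.

Lemma Rintegral_chacon_T (F : chacon_space -> R) : measurable_fun setT F ->
  (\int[mu]_x F (chacon_T x) = \int[mu]_x F x)%R.
Proof.
move=> mF; rewrite /Rintegral [in LHS]integralE [in RHS]integralE.
have mE : measurable_fun setT (EFin \o F) by exact/measurable_EFinP.
have [mp mn] := (measurable_funepos mE, measurable_funeneg mE).
have p0 x : 0 <= (EFin \o F)^\+ x by exact: funepos_ge0.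
have n0 x : 0 <= (EFin \o F)^\- x by exact: funeneg_ge0.
congr (fine (_ - _)).
  rewrite -[RHS](ge0_integral_chacon_T mp p0); apply: eq_integral => x _.
  by rewrite !funeposE.
rewrite -[RHS](ge0_integral_chacon_T mn n0); apply: eq_integral => x _.
by rewrite !funenegE.
Qed.

Lemma L2_koopman f : L2 mu f -> L2 mu (koopman f).
Proof.
have mT := measurable_shift_X 1.
case=> mRe mIm f2; split.
- exact: (measurableT_comp mRe mT).
- exact: (measurableT_comp mIm mT).
rewrite (ge0_integral_chacon_T (F := fun x => (ComplexField.Normc.normc (f x) ^+ 2)%:E))//.
  apply/measurable_EFinP.
  rewrite (_ : (fun x => _) = (fun x =>
      (complex.Re (f x)) ^+ 2 + (complex.Im (f x)) ^+ 2)%R).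
    by apply: measurable_funD; exact: measurable_funX.
  apply/funext => x; case: (f x) => a b /=.
  by rewrite sqr_sqrtr// addr_ge0// sqr_ge0.
by move=> x; rewrite lee_fin sqr_ge0.
Qed.

Lemma inner_koopman f g : L2 mu f -> L2 mu g ->
  inner mu (koopman f) (koopman g) = inner mu f g.
Proof.
case=> mfR mfI _ [mgR mgI _]; rewrite /inner /cintegral.
have ReE x : complex.Re (f x * (g x)^*%C)%R =
    (complex.Re (f x) * complex.Re (g x) + complex.Im (f x) * complex.Im (g x))%R.
  by case: (f x) (g x) => a b [c d] /=; rewrite mulrN opprK.
have ImE x : complex.Im (f x * (g x)^*%C)%R =
    (complex.Im (f x) * complex.Re (g x) - complex.Re (f x) * complex.Im (g x))%R.
  by case: (f x) (g x) => a b [c d] /=; rewrite mulrN addrC.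
congr (_ +i* _)%C.
  rewrite (Rintegral_chacon_T (F := fun x => complex.Re (f x * (g x)^*%C)%R))//.
  rewrite (funext ReE); apply: measurable_funD; exact: measurable_funM.
rewrite (Rintegral_chacon_T (F := fun x => complex.Im (f x * (g x)^*%C)%R))//.
rewrite (funext ImE); apply: measurable_funB; exact: measurable_funM.
Qed.

End unitary.

Definition koopman_exp (k : int) : (chacon_space -> R[i]) -> chacon_space -> R[i] :=
  match k with
  | Posz n => iter n koopman
  | Negz n => iter n.+1 koopman_inv
  end.

Definition koopman_poly (P : {poly R[i]}) f : chacon_space -> R[i] :=
  fun x => \sum_(j < size P) P`_j * koopman_exp j f x.

(* A sum over all of int; rho_finite_support makes it a finite one. *)
Definition koopman_rho (nu : probability adic3 R) (m : nat) f :
    chacon_space -> R[i] :=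
  fun x => \sum_(k \in [set: int])
    (fine (rho nu m [set k]))%:C * koopman_exp k f x.

End koopman.

(* Main.v *)
Require Import Defs.
From mathcomp Require Import all_boot all_order all_algebra.
From mathcomp Require Import all_classical all_reals all_analysis.
From mathcomp Require Import complex.
From mathcomp Require Import measurable_realfun zify ring lra.
Set Implicit Arguments.
Unset Strict Implicit.
Unset Printing Implicit Defensive.
Import Order.TTheory GRing.Theory Num.Theory.
Import numFieldNormedType.Exports.
Local Open Scope classical_set_scope.
Local Open Scope ring_scope.

(* For every n the one-sided Chacon word is a concatenation of copies of w_n, with
   phi0(j) spacers between the copies of index j and j+1, whatever n is.  Moving
   back through m copies therefore takes m * h_n + k steps, where k is a value
   of the cocycle sum phi0^(m), so that T^(-m h_n) sends most points to T^k of a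
   point at the same height of the n-th tower.  As the sums over m consecutive
   gaps are distributed like rho_m, comparing frequencies in the word bounds the
   difference of the two correlations of events determined by finite windows by
   C / h_n.  The correlations are bounded bilinear forms on L^2, uniformly in n,
   and the finite-window events form a pi-system generating the Borel sets; so a
   Dynkin class argument and L^2-approximation extend the limit to all of L^2. *)

(** * Blocks of the Chacon word *)

(** Two limits are kept apart. With n fixed, positions are counted in prefixes made of 3^K blocks
    and K tends to infinity: this is where the gap sums equidistribute, and all that survives is the
    waste at the ends of the blocks, boundedly many positions out of about [h_n]. Only afterwards
    does n grow. The gaps do not depend on n because [w_(n+1) = w_n w_n 1 w_n] puts the gaps 0 and 1
    inside a block and leaves the third gap to the next level. Descending through the levels is
    reading the base-3 digits of j until one differs from 2, which is [phi0] at the integer j. The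
    measure is known only through a one-sided word, so correlations are first translated until both
    windows have nonnegative coordinates. The form to be killed is bilinear, hence the extension to
    L^2 is carried out once in each argument. The bounds are stated as [e^-1 <F,F> + e <G,G>] with a
    free parameter e, which replaces Cauchy-Schwarz and avoids square roots. *)

Definition adic3_of_nat (j : nat) : adic3 := fun k => inZp (j %/ 3 ^ k).

Lemma adic3_trunc_of_nat j n : adic3_trunc (adic3_of_nat j) n = (j %% 3 ^ n)%N.
Proof.
elim: n => [|n IHn]; first by rewrite /adic3_trunc big_ord0 modn1.
rewrite adic3_truncS IHn (_ : digit _ n = (j %/ 3 ^ n) %% 3)%N//.
rewrite -[in RHS](modn_dvdm (m := 3 ^ n.+1) j (dvdnn _)).
have -> : (j %% 3 ^ n = (j %% 3 ^ n.+1) %% 3 ^ n)%N.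
  by rewrite modn_dvdm// dvdn_exp2l.
have -> : ((j %/ 3 ^ n) %% 3 = (j %% 3 ^ n.+1) %/ 3 ^ n)%N.
  by rewrite modn_divl -expnS.
by rewrite modn_mod addnC -divn_eq.
Qed.

Lemma adic3_trunc_lt y n : (adic3_trunc y n < 3 ^ n)%N.
Proof.
elim: n => [|n IHn]; first by rewrite /adic3_trunc big_ord0.
rewrite adic3_truncS expnS (@leq_ltn_trans (adic3_trunc y n + 2 * 3 ^ n))//.
  rewrite leq_add2l leq_mul2r; apply/orP; right.
  by rewrite -ltnS /digit; case: (y n).
by rewrite mulSn ltn_add2r.
Qed.

Lemma eq_adic3_trunc y z n : adic3_trunc y n = adic3_trunc z n ->
  forall i, (i < n)%N -> y i = z i.
Proof.
elim: n => [//|n IHn]; rewrite !adic3_truncS => yz.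
have yz0 : adic3_trunc y n = adic3_trunc z n.
  have := congr1 (modn^~ (3 ^ n))%N yz.
  by rewrite addnC [in RHS]addnC !modnMDl !modn_small ?adic3_trunc_lt.
move=> i; rewrite ltnS leq_eqVlt => /predU1P[->|]; last exact: IHn.
move: yz; rewrite yz0 => /addnI/eqP; rewrite eqn_mul2r expn_eq0/=.
by move=> /eqP yzn; apply/val_inj.
Qed.

Lemma eq_trunc_adic3 y z n : (forall i, (i < n)%N -> y i = z i) ->
  adic3_trunc y n = adic3_trunc z n.
Proof. by move=> yz; apply: eq_bigr => k _; rewrite /digit yz. Qed.

Lemma adic3_trunc_odometer y n :
  adic3_trunc (odometer y) n = ((adic3_trunc y n).+1 %% 3 ^ n)%N.
Proof.
rewrite adic3_trunc_add.
have -> : adic3_trunc adic3_one n = (1 %% 3 ^ n)%N.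
  rewrite -adic3_trunc_of_nat; congr adic3_trunc; apply/funext => k.
  by congr inZp; case: k => [//|k]; rewrite divn_small// -(expn0 3) ltn_exp2l.
by rewrite modnDmr addn1.
Qed.

Lemma odometer_of_nat j : odometer (adic3_of_nat j) = adic3_of_nat j.+1.
Proof.
apply/funext => k; apply: (@eq_adic3_trunc _ _ k.+1) => //.
by rewrite adic3_trunc_odometer !adic3_trunc_of_nat -addn1 modnDml addn1.
Qed.

Lemma adic3_trunc_max y n : (forall i, (i < n)%N -> digit y i = 2) ->
  (adic3_trunc y n).+1 = (3 ^ n)%N.
Proof.
elim: n => [|n IHn] y2; first by rewrite /adic3_trunc big_ord0.
rewrite adic3_truncS y2// -addSn IHn => [|i /ltnW/y2//].
by rewrite expnS mulSn addnC.
Qed.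

(** The bound excludes that the first n digits are all 2, so the first digit different from 2, which
    decides [phi0], is among them. *)
Lemma phi0_trunc y z n : ((adic3_trunc y n).+1 < 3 ^ n)%N ->
  adic3_trunc y n = adic3_trunc z n -> phi0 y = phi0 z.
Proof.
move=> yn yz; suff wlog_imp u v : ((adic3_trunc u n).+1 < 3 ^ n)%N ->
    adic3_trunc u n = adic3_trunc v n ->
    first_non2_is1 u -> first_non2_is1 v.
  rewrite /phi0; congr ((nat_of_bool _)%:Z); apply/asbool_equiv_eq.
  by split; apply: wlog_imp; rewrite -?yz.
move=> un uv [k [k2 k1]]; have {}uv := eq_adic3_trunc uv.
have kn : (k < n)%N.
  rewrite ltnNge; apply/negP => nk; move: un; rewrite adic3_trunc_max ?ltnn//.
  by move=> i i_n; apply: k2; exact: leq_trans nk.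
exists k; split=> [i ik|]; rewrite /digit -uv//; first exact: k2.
exact: ltn_trans kn.
Qed.

(* Between the copies of index j and j.+1 of w_n in the infinite word there are
   gap j spacers, whatever n is. *)
Definition gap (j : nat) : nat := `[< first_non2_is1 (adic3_of_nat j) >].

Lemma gap_le1 j : (gap j <= 1)%N. Proof. exact: leq_b1. Qed.

Lemma gap_mul3 q : gap (3 * q) = 0.
Proof.
rewrite /gap; case: asboolP => //= -[[|k] [k2 k1]].
  by move: k1; rewrite /digit /= divn1 modnMr.
by have := k2 0%N (ltn0Sn _); rewrite /digit /= divn1 modnMr.
Qed.

Lemma gap_mul3D1 q : gap (3 * q + 1) = 1.
Proof.
rewrite /gap; case: asboolP => //= -[]; exists 0%N; split => //.
by rewrite /digit /= divn1 mulnC modnMDl.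
Qed.

(** A lowest digit 2 is skipped, so deleting it changes nothing. In the word, the copy of [w_n] of
    index 3q+2 ends the q-th copy of [w_(n+1)] and shares the gap that follows it. *)
Lemma gap_mul3D2 q : gap (3 * q + 2) = gap q.
Proof.
have dS i : digit (adic3_of_nat (3 * q + 2)) i.+1 = digit (adic3_of_nat q) i.
  by rewrite /digit /= expnS divnMA mulnC divnMDl// addn0.
have d0 : digit (adic3_of_nat (3 * q + 2)) 0 = 2.
  by rewrite /digit /= divn1 mulnC modnMDl.
rewrite /gap; congr (nat_of_bool _); apply/asbool_equiv_eq; split.
  move=> [[|k] [k2 k1]]; first by rewrite d0 in k1.
  by exists k; split=> [i ik|]; rewrite -dS//; exact: k2.
by move=> [k [k2 k1]]; exists k.+1; split=> [[//|i] ik|]; rewrite dS//; exact: k2.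
Qed.

Definition gap_sum (j m : nat) : nat := (\sum_(i < m) gap (j + i))%N.

Lemma gap_sum_le j m : (gap_sum j m <= m)%N.
Proof.
rewrite -[leqRHS]card_ord -sum1_card leq_sum// => i _; exact: gap_le1.
Qed.

Lemma gap_sumD j m n : gap_sum j (m + n) = (gap_sum j m + gap_sum (j + m) n)%N.
Proof.
rewrite /gap_sum big_split_ord /=; congr (_ + _)%N.
by apply: eq_bigr => i _; rewrite addnA.
Qed.

Lemma gap_sum1 j : gap_sum j 1 = gap j.
Proof. by rewrite /gap_sum big_ord1 addn0. Qed.

(** Three consecutive gaps consist of one interior spacer and the gap inherited from the coarser
    level. Combined with [h_(n+1) = 3 h_n + 1], this makes the block starts of levels n and n+1
    agree in [block_pos_mul3]. *)
Lemma gap_sum_mul3 q : gap_sum 0 (3 * q) = (q + gap_sum 0 q)%N.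
Proof.
elim: q => [|q IHq]; first by rewrite /gap_sum !big_ord0.
have three : gap_sum (3 * q) 3 = (gap q).+1.
  rewrite /gap_sum !big_ord_recl big_ord0 /= addn0 gap_mul3.
  by rewrite gap_mul3D1 gap_mul3D2 addn0.
rewrite mulnS addnC gap_sumD IHq add0n three.
by rewrite -[q.+1 in RHS]addn1 gap_sumD gap_sum1 add0n; lia.
Qed.

Lemma iter_odometer_of_nat i j :
  iter i odometer (adic3_of_nat j) = adic3_of_nat (j + i).
Proof.
elim: i => [|i IHi]; first by rewrite addn0.
by rewrite iterS IHi odometer_of_nat addnS.
Qed.

Lemma phi0_sum_of_nat m j : phi0_sum m (adic3_of_nat j) = (gap_sum j m)%:Z.
Proof.
rewrite /phi0_sum /gap_sum (big_morph Posz PoszD (erefl _)).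
by apply: eq_bigr => i _; rewrite iter_odometer_of_nat.
Qed.

(** Adding 1 up to m times never carries out of the first n digits, so y may be replaced by the
    integer that these digits represent. *)
Lemma phi0_sum_trunc m y n : (adic3_trunc y n + m < 3 ^ n)%N ->
  phi0_sum m y = (gap_sum (adic3_trunc y n) m)%:Z.
Proof.
move=> ynm; rewrite -phi0_sum_of_nat; set t := adic3_trunc y n.
have tr i : (i <= m)%N -> adic3_trunc (iter i odometer y) n = (t + i)%N.
  elim: i => [|i IHi] im; first by rewrite addn0.
  rewrite iterS adic3_trunc_odometer IHi 1?ltnW// -addnS modn_small//; lia.
apply: eq_bigr => i _; apply: (@phi0_trunc _ _ n).
  by rewrite tr ?(ltnW (ltn_ord i))//; move: ynm (ltn_ord i); rewrite -/t; lia.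
rewrite tr ?(ltnW (ltn_ord i))// iter_odometer_of_nat adic3_trunc_of_nat modn_small//.
by move: ynm (ltn_ord i); rewrite -/t; lia.
Qed.

(** Starting position of the copy of index j of [w_n], after j copies and the spacers between
    them. *)
Definition block_pos (n j : nat) : nat := (j * tower_height n + gap_sum 0 j)%N.

Lemma block_posD n j m :
  block_pos n (j + m) = (block_pos n j + m * tower_height n + gap_sum j m)%N.
Proof. by rewrite /block_pos gap_sumD add0n mulnDl; lia. Qed.

Lemma block_posS n j : block_pos n j.+1 = (block_pos n j + (tower_height n + gap j))%N.
Proof. by rewrite -addn1 block_posD gap_sum1 mul1n addnA. Qed.

Lemma block_pos_mul3 n q : block_pos n (3 * q) = block_pos n.+1 q.
Proof. by rewrite /block_pos gap_sum_mul3 /=; lia. Qed.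

Lemma block_pos_mul3D1 n q :
  block_pos n (3 * q + 1) = (block_pos n.+1 q + tower_height n)%N.
Proof. by rewrite block_posD block_pos_mul3 gap_sum1 gap_mul3; lia. Qed.

Lemma block_pos_mul3D2 n q :
  block_pos n (3 * q + 2) = (block_pos n.+1 q + 2 * tower_height n + 1)%N.
Proof.
rewrite (_ : 3 * q + 2 = 3 * q + 1 + 1)%N; last by lia.
rewrite block_posD block_pos_mul3D1 gap_sum1 gap_mul3D1; lia.
Qed.

(** Strong induction on j with n varying: for j = 3q + r > 0, the copy is the r-th of the three
    copies of [w_n] in the copy of index q < j of [w_(n+1)]. The descent ends at j = 0, where [w_n]
    is a prefix. *)
Lemma chacon_inf_block n j t : (t < tower_height n)%N ->
  chacon_inf (block_pos n j + t) = nth false (chacon_word n) t.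
Proof.
elim/ltn_ind: j n t => j IHj n t tn.
have [->|j_gt0] := posnP j.
  by rewrite /block_pos /gap_sum big_ord0 (@chacon_infE n).
have [q [r [jE qj r3]]] : exists q r, [/\ j = (3 * q + r)%N, (q < j)%N & (r < 3)%N].
  exists (j %/ 3)%N, (j %% 3)%N; split; [|exact: ltn_Pdiv|exact: ltn_pmod].
  by rewrite mulnC -divn_eq.
move: r3; rewrite jE; case: r {jE} => [|[|[|//]]] _.
- rewrite addn0 block_pos_mul3 IHj//; last by rewrite /=; lia.
  by rewrite chacon_wordS nth_cat size_chacon_word tn.
- rewrite block_pos_mul3D1 -addnA IHj//; last by rewrite /=; lia.
  rewrite chacon_wordS nth_cat size_chacon_word ltnNge leq_addr/= addKn.
  by rewrite nth_cat size_chacon_word tn.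
- rewrite block_pos_mul3D2 -(addnA _ _ t) -(addnA _ _ (1 + t)%N).
  rewrite IHj//; last by rewrite /=; lia.
  rewrite chacon_wordS nth_cat size_chacon_word ifF; last by lia.
  rewrite nth_cat size_chacon_word ifF; last by lia.
  by rewrite (_ : _ - _ - _ = t.+1)%N//; lia.
Qed.

Definition inf_window (l i : nat) : seq bool :=
  mkseq (fun j => chacon_inf (i + j)) l.

Lemma inf_window_block l n j t : (t + l <= tower_height n)%N ->
  inf_window l (block_pos n j + t) = inf_window l t.
Proof.
move=> tl; apply/eq_in_map => i; rewrite mem_iota /= add0n => il.
rewrite -addnA chacon_inf_block; last by lia.
by rewrite (@chacon_infE n)//; lia.
Qed.

(** * Equidistribution of the gap sums *)

Lemma fine_probability_partition d (T : measurableType d) (R : realType)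
    (P : probability T R) (I : finType) (F : I -> set T) (E : set T) :
  measurable E -> (forall i, measurable (F i)) -> trivIset setT F ->
  (forall x, exists i, F i x) ->
  fine (P E) = \sum_(i : I) fine (P (E `&` F i)).
Proof.
move=> mE mF tF cF.
have mEF i : measurable (E `&` F i) by exact: measurableI.
have EE : E = \bigcup_(i in setT) (E `&` F i).
  apply/seteqP; split=> [x Ex|x [i _ []]//].
  by have [i Fix] := cF x; exists i.
have fI : finite_set [set: I] by exact: finite_finset.
rewrite {1}EE measure_fin_bigcup//; last exact: trivIset_setIl.
have -> : [set: I] = [set` enum I].
  by apply/seteqP; split=> i //= _; rewrite mem_enum.
rewrite -fsbig_seq ?enum_uniq// big_enum /=.
under eq_bigr do rewrite -[P _]fineK ?fin_num_measure//.
by rewrite sumEFin.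
Qed.

Section haar.
Context {R : realType} (nu : probability adic3 R) (nu_haar : haar_probability nu).

Definition trunc_fiber n t : set adic3 := [set y | adic3_trunc y n = t].

Lemma measurable_trunc_fiber n t : measurable (trunc_fiber n t).
Proof.
apply: sub_sigma_algebra; rewrite openE => y yt; rewrite /interior.
apply: filterS (nbhs_digits y n) => z /eq_trunc_adic3 zy.
by rewrite /trunc_fiber /= zy.
Qed.

(** Translation by 1 permutes the 3^n fibers cyclically, so they have equal measure, and the
    measures add up to 1. *)
Lemma haar_trunc_fiber n t : (t < 3 ^ n)%N ->
  fine (nu (trunc_fiber n t)) = (3 ^ n)%:R^-1.
Proof.
have shift s : (s.+1 < 3 ^ n)%N ->
    nu (trunc_fiber n s.+1) = nu (trunc_fiber n s).
  move=> sn; rewrite -(nu_haar (adic3_of_nat 1) (measurable_trunc_fiber n s.+1)).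
  congr (nu _); apply/seteqP; split => y;
    rewrite /trunc_fiber /= adic3_trunc_add adic3_trunc_of_nat modnDml add1n.
    have [yn|] := ltnP (adic3_trunc y n).+1 (3 ^ n).
      by rewrite modn_small// => -[].
    have := adic3_trunc_lt y n; rewrite leq_eqVlt => /predU1P[->|].
      by rewrite modnn.
    by move=> + ny; rewrite ltnNge ny.
  by move=> ->; rewrite modn_small.
have const s : (s < 3 ^ n)%N -> nu (trunc_fiber n s) = nu (trunc_fiber n 0).
  by elim: s => [//|s IHs] sn; rewrite shift// IHs// ltnW.
have : fine (nu setT) = \sum_(s < 3 ^ n) fine (nu (setT `&` trunc_fiber n s)).
  apply: (fine_probability_partition nu (F := fun s : 'I_(3 ^ n) =>
    trunc_fiber n s)) => //.
  - move=> i; exact: measurable_trunc_fiber.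
  - by move=> i j _ _ [y [/= yi yj]]; apply/val_inj; rewrite /= -yi -yj.
  - by move=> y; exists (Ordinal (adic3_trunc_lt y n)).
rewrite probability_setT /=.
under eq_bigr => s _ do rewrite setTI const//.
rewrite sumr_const card_ord => one tn; rewrite const//.
apply: (mulIf (x := (3 ^ n)%:R)); first by rewrite pnatr_eq0 expn_eq0.
by rewrite mulr_natr -one mulVf// pnatr_eq0 expn_eq0.
Qed.

(** The cocycle sum is constant on the fiber of s as soon as s + m < 3^n. At most m fibers remain,
    each contributing an error of at most 3^-n. *)
Lemma rho_frequency m k :
  (fun n : nat => (\sum_(j < 3 ^ n) (gap_sum j m == k))%N%:R / (3 ^ n)%:R) @ \oo
    --> fine (rho nu m [set k%:Z]).
Proof.
set E := phi0_sum m @^-1` [set k%:Z].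
have mE : measurable E.
  by rewrite -[E]setTI; apply: measurable_phi0_sum.
have mF n i := measurable_trunc_fiber n i.
have bound n : `|fine (nu E) -
    (\sum_(j < 3 ^ n) (gap_sum j m == k))%N%:R / (3 ^ n)%:R| <= m%:R / 3 ^+ n.
  have -> : fine (nu E) = \sum_(s < 3 ^ n) fine (nu (E `&` trunc_fiber n s)).
    apply: (fine_probability_partition nu (F := fun s : 'I_(3 ^ n) =>
      trunc_fiber n s)) => //.
    - by move=> i j _ _ [y [/= yi yj]]; apply/val_inj; rewrite /= -yi -yj.
    - by move=> y; exists (Ordinal (adic3_trunc_lt y n)).
  rewrite natr_sum mulr_suml -sumrB.
  apply: le_trans (ler_norm_sum _ _ _) _.
  apply: (@le_trans _ _ (\sum_(s < 3 ^ n) (3 ^ n <= s + m)%N%:R / 3 ^+ n)).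
    apply: ler_sum => s _; have [sm|sm] := leqP (3 ^ n) (s + m).
      rewrite mul1r.
      have le0 : 0 <= fine (nu (E `&` trunc_fiber n s)) <= (3 ^+ n)^-1.
        rewrite fine_ge0//= -natrX -(haar_trunc_fiber (ltn_ord s)).
        rewrite fine_le ?fin_num_measure//; try exact: measurableI.
        by apply: le_measure; rewrite ?inE//; exact: measurableI.
      have ge0 : 0 <= (3 ^+ n)^-1 :> R by rewrite invr_ge0 exprn_ge0.
      case: eqP => _ /=; rewrite ?mul0r ?mul1r ?subr0 -?natrX.
        by rewrite ler_norml natrX; lra.
      by rewrite ger0_norm//; case/andP: le0 => //; rewrite natrX.
    rewrite mul0r (_ : fine _ = (gap_sum s m == k)%:R / (3 ^ n)%:R).
      by rewrite subrr normr0.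
    have yE y : trunc_fiber n s y -> phi0_sum m y = (gap_sum s m)%:Z.
      by move=> ys; rewrite (@phi0_sum_trunc _ _ n) ys.
    case: eqP => gk /=.
      rewrite mul1r -(haar_trunc_fiber (ltn_ord s)) (_ : _ `&` _ = trunc_fiber n s)//.
      by apply/seteqP; split=> [y []//|y ys]; split=> //; rewrite /E /= yE ?gk.
    rewrite mul0r (_ : _ `&` _ = set0) ?measure0//.
    by rewrite -subset0 => y [+ /yE yg]; rewrite /E /= yg => -[].
  rewrite -mulr_suml ler_wpM2r ?invr_ge0 ?exprn_ge0// -natr_sum ler_nat.
  have [nm|mn] := leqP (3 ^ n) m.
    apply: leq_trans nm; rewrite -[leqRHS]card_ord -sum1_card leq_sum// => i _.
    exact: leq_b1.
  rewrite -(subnK (ltnW mn)) big_split_ord /= big1 ?add0n => [|i _]; last first.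
    by rewrite leqNgt ltn_add2r ltn_ord.
  rewrite -[leqRHS]card_ord -sum1_card leq_sum// => i _; exact: leq_b1.
have z1 : `|3^-1| < 1 :> R by rewrite ger0_norm; lra.
have /cvgrPdist_le gz := cvg_geometric (m%:R : R) z1.
apply/cvgrPdist_le => e e0; near=> n.
rewrite (le_trans (bound n))//.
have : `|0 - geometric m%:R 3^-1 n| <= e :> R by near: n; exact: gz.
by rewrite sub0r normrN /= exprVn ger0_norm// mulr_ge0// invr_ge0 exprn_ge0.
Unshelve. all: by end_near. Qed.
End haar.

(** * Frequencies in the Chacon word *)

Lemma sum_block_pos n J (f : nat -> nat) : (\sum_(i < block_pos n J) f i =
  \sum_(j < J) \sum_(t < tower_height n + gap j) f (block_pos n j + t))%N.
Proof.
elim: J => [|J IHJ]; first by rewrite big_ord0 /block_pos /gap_sum !big_ord0.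
by rewrite block_posS big_split_ord /= IHJ [RHS]big_ord_recr.
Qed.

(** The uncontrolled positions are the last C of the copy and at most one spacer, whence [C.+1]. If
    C exceeds the height, the truncated subtraction makes the controlled range empty and the bound
    still holds. *)
Lemma sum_block_bounds n C j (f g : nat -> bool) :
  (forall t, (t < tower_height n - C)%N -> f (block_pos n j + t)%N = g t) ->
  (\sum_(t < tower_height n - C) g t <=
    \sum_(t < tower_height n + gap j) f (block_pos n j + t) <=
    \sum_(t < tower_height n - C) g t + C.+1)%N.
Proof.
move=> fg; set h := (tower_height n - C)%N.
have -> : (\sum_(t < h) g t = \sum_(t < h) f (block_pos n j + t))%N.
  by apply: eq_bigr => t _; rewrite fg.
rewrite (_ : tower_height n + gap j = h + (tower_height n + gap j - h))%N; last first.
  by rewrite /h; lia.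
rewrite big_split_ord /= leq_addr leq_add2l /=.
apply: (@leq_trans (tower_height n + gap j - h)); last first.
  by rewrite /h; have := gap_le1 j; lia.
rewrite -[leqRHS]card_ord -sum1_card leq_sum// => i _; exact: leq_b1.
Qed.

Lemma sum_gap_sum m J (S : nat -> nat) : (\sum_(j < J) S (gap_sum j m) =
  \sum_(k < m.+1) (\sum_(j < J) (gap_sum j m == k)) * S k)%N.
Proof.
under [RHS]eq_bigr do rewrite big_distrl /=.
rewrite exchange_big /=; apply: eq_bigr => j _.
have km : (gap_sum j m < m.+1)%N by rewrite ltnS gap_sum_le.
rewrite (bigD1 (Ordinal km))//= eqxx mul1n big1 ?addn0// => i.
by rewrite -val_eqE /= eq_sym => /negPf->.
Qed.

(* Up to the C last positions of a block, the position m * h_n further on is the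
   position k = gap_sum j m backwards in a later copy of the same word w_n. *)
Lemma count_shifted_block (R : realType) (a b : nat -> bool) (l m n J : nat)
    (r : nat -> R) :
  (forall j t, (t + l <= tower_height n)%N -> a (block_pos n j + t)%N = a t) ->
  (forall j t, (t + l <= tower_height n)%N -> b (block_pos n j + t)%N = b t) ->
  (forall k, 0 <= r k <= 1) ->
  `|(\sum_(i < block_pos n J) (a (i + m) && b (i + m + m * tower_height n)))%N%:R
    - \sum_(k < m.+1)
        r k * (\sum_(i < block_pos n J) (a (i + m) && b (i + m - k)))%N%:R| <=
  J%:R * ((m + l).+1 * m.+2)%N%:R + (tower_height n)%:R *
    \sum_(k < m.+1) `|(\sum_(j < J) (gap_sum j m == k))%N%:R - r k * J%:R|.
Proof.
move=> ha hb r01; set h := tower_height n; set C := (m + l)%N.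
(* The controlled count of a single copy of [w_n] with relative displacement k; it is the same for
   every block. *)
pose S k := (\sum_(t < h - C) (a (t + m) && b (t + m - k)))%N.
set X := (\sum_(i < _) _)%N.
have Xb : (\sum_(j < J) S (gap_sum j m) <= X <=
    \sum_(j < J) S (gap_sum j m) + J * C.+1)%N.
  rewrite /X (sum_block_pos n J (fun i => (a (i + m) && b (i + m + m * h)) : nat))%N.
  have : forall j : 'I_J, (S (gap_sum j m) <= \sum_(t < h + gap j)
      (a (block_pos n j + t + m) && b (block_pos n j + t + m + m * h)) <=
      S (gap_sum j m) + C.+1)%N.
    move=> j; apply: (@sum_block_bounds n C j
      (fun i => a (i + m) && b (i + m + m * h))%N
      (fun t => a (t + m) && b (t + m - gap_sum j m)))%N => t th.
    rewrite -addnA ha; last by move: th; rewrite /C; lia.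
    (* By [block_posD], advancing by m * h from copy j leads into copy j + m, at a height lowered by
       [gap_sum j m]. *)
    congr (_ && _); rewrite -(@hb (j + m)%N (t + m - gap_sum j m)%N).
      congr b; rewrite block_posD.
      by have := gap_sum_le j m; rewrite -/h; lia.
    by move: th; rewrite /C; lia.
  move=> H; rewrite leq_sum/=; last by move=> j _; have /andP[] := H j.
  have -> : (J * C.+1 = \sum_(j < J) C.+1)%N by rewrite sum_nat_const card_ord.
  by rewrite -big_split/= leq_sum// => j _; have /andP[] := H j.
have Yb k : (k < m.+1)%N -> (J * S k <=
    \sum_(i < block_pos n J) (a (i + m) && b (i + m - k)) <=
    J * S k + J * C.+1)%N.
  rewrite ltnS => km.
  rewrite (sum_block_pos n J (fun i => (a (i + m) && b (i + m - k)) : nat))%N.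
  have H : forall j : 'I_J, (S k <= \sum_(t < h + gap j)
      (a (block_pos n j + t + m) && b (block_pos n j + t + m - k)) <=
      S k + C.+1)%N.
    move=> j; apply: (@sum_block_bounds n C j
      (fun i => a (i + m) && b (i + m - k))%N
      (fun t => a (t + m) && b (t + m - k)))%N => t th.
    rewrite -addnA ha; last by move: th; rewrite /C; lia.
    rewrite -addnBA; last by lia.
    by rewrite hb//; move: th; rewrite /C; lia.
  rewrite -mulnDr; have -> : (J * S k = \sum_(j < J) S k)%N.
    by rewrite sum_nat_const card_ord.
  have -> : (J * (S k + C.+1) = \sum_(j < J) (S k + C.+1))%N.
    by rewrite sum_nat_const card_ord.
  by apply/andP; split; apply: leq_sum => j _; have /andP[] := H j.
have Sh k : (S k <= h)%N.
  apply: (@leq_trans (h - C)); last exact: leq_subr.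
  rewrite -[leqRHS]card_ord -sum1_card leq_sum// => i _; exact: leq_b1.
pose D k : R := (\sum_(j < J) (gap_sum j m == k))%N%:R.
pose Y k : R := (\sum_(i < block_pos n J) (a (i + m) && b (i + m - k)))%N%:R.
pose s : R := \sum_(k < m.+1) D k * (S k)%:R.
have sE : ((\sum_(j < J) S (gap_sum j m))%N%:R = s :> R).
  by rewrite sum_gap_sum natr_sum; apply: eq_bigr => k _; rewrite natrM.
(* Three replacements: X by its blockwise value s, then for each k the number [D k] of indices by
   its expected value [r k * J], and [J * S k] by the actual count [Y k]. *)
have -> : X%:R - \sum_(k < m.+1) r k * Y k = (X%:R - s)
    + \sum_(k < m.+1) ((D k - r k * J%:R) * (S k)%:R
                       + r k * (J%:R * (S k)%:R - Y k)).
  rewrite -[X%:R - s + _]addrA; congr (_ + _).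
  apply/eqP; rewrite -subr_eq0 opprD !opprK /s; apply/eqP.
  rewrite -sumrN -!sumrN -!big_split/=; apply: big1 => k _; ring.
(* The factor [m.+2] is 1 + (m + 1): one boundary error for X and one for each [Y k], whose weight
   [r k] is at most 1. *)
rewrite (_ : J%:R * _ = J%:R * C.+1%:R + \sum_(k < m.+1) J%:R * C.+1%:R); last first.
  by rewrite sumr_const card_ord -mulrS natrM mulrA mulr_natr.
rewrite mulr_sumr -[leRHS]addrA -big_split/=.
apply: le_trans (ler_normD _ _) _; apply: lerD.
  rewrite -sE -natrM; move: Xb => /andP[X1 X2].
  by rewrite ger0_norm ?subr_ge0 ?ler_nat// lerBlDl -natrD ler_nat.
apply: le_trans (ler_norm_sum _ _ _) _; apply: ler_sum => k _.
rewrite [leRHS]addrC; apply: le_trans (ler_normD _ _) _; apply: lerD.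
  by rewrite normrM mulrC ler_wpM2r// ger0_norm// ler_nat.
rewrite normrM; have /andP[Y1 Y2] := Yb k (ltn_ord k).
have /andP[rk0 rk1] := r01 k.
rewrite (ger0_norm rk0) distrC -[leRHS]mul1r ler_pM//.
by rewrite -!natrM ger0_norm ?subr_ge0 ?ler_nat// lerBlDl -natrD ler_nat.
Qed.

Lemma cvg_finsum (R : realType) (I : finType) (u : I -> nat -> R) (l : I -> R) :
  (forall i, u i @ \oo --> l i) ->
  (fun n => \sum_i u i n) @ \oo --> \sum_i l i.
Proof. by move=> ul; apply: cvg_big => // x; exact: add_continuous. Qed.

Definition has_frequency (R : realType) (e : nat -> bool) (c : R) : Prop :=
  (fun N : nat => (\sum_(i < N) e i)%N%:R / N%:R) @ \oo --> c.

(** The bound of [count_shifted_block] is divided by the prefix length, which is at least 3^K h. The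
    boundary errors become a constant over h, and the deviation of the gap sums from [rho] vanishes
    as K grows. *)
Lemma frequency_shifted_block (R : realType) (nu : probability adic3 R)
    (a b : nat -> bool) (l m n : nat) (c : R) (d : nat -> R) :
  haar_probability nu ->
  (forall j t, (t + l <= tower_height n)%N -> a (block_pos n j + t)%N = a t) ->
  (forall j t, (t + l <= tower_height n)%N -> b (block_pos n j + t)%N = b t) ->
  has_frequency (fun i => a (i + m)%N && b (i + m + m * tower_height n)%N) c ->
  (forall k, (k <= m)%N ->
    has_frequency (fun i => a (i + m)%N && b (i + m - k)%N) (d k)) ->
  `|c - \sum_(k < m.+1) fine (rho nu m [set k%:Z]) * d k| <=
    ((m + l).+1 * m.+2)%N%:R / (tower_height n)%:R.
Proof.
move=> nu_haar ha hb hc hd; set h := tower_height n.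
pose r (k : nat) : R := fine (rho nu m [set k%:Z]).
have r01 k : 0 <= r k <= 1.
  rewrite /r fine_ge0//= -[leRHS]/(fine 1%:E) fine_le ?fin_num_measure//.
  exact: probability_le1.
have h_gt0 : 0 < h%:R :> R.
  by rewrite ltr0n (leq_ltn_trans _ (tower_height_gt n)).
(* Frequencies may be computed along this subsequence, chosen because [rho_frequency] averages over
   exactly 3^K indices. *)
pose N K := block_pos n (3 ^ K).
have NJ K : (3 ^ K * h <= N K)%N by rewrite /N /block_pos leq_addr.
have N_gt0 K : 0 < (N K)%:R :> R.
  rewrite ltr0n (leq_trans _ (NJ K))// muln_gt0 expn_gt0 /=.
  by rewrite -(ltr0n R).
have Noo : N @ \oo --> \oo.
  apply/cvgnyPge => A; near=> K; apply: leq_trans (NJ K).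
  apply: (@leq_trans K); first by near: K; exists A.
  apply: (@leq_trans (3 ^ K)); first by rewrite ltnW// ltn_expl.
  by rewrite leq_pmulr// -(ltr0n R).
have freqN e x : has_frequency e x ->
    (fun K => (\sum_(i < N K) e i)%N%:R / (N K)%:R : R) @ \oo --> x.
  by move=> ex; exact: (cvg_comp N _ Noo ex).
have ucvg := freqN _ _ hc.
have ycvg : (fun K => \sum_(k < m.+1) r k *
    ((\sum_(i < N K) (a (i + m) && b (i + m - k)))%N%:R / (N K)%:R)) @ \oo -->
    \sum_(k < m.+1) r k * d k.
  apply: cvg_finsum => k; apply: cvgM; first exact: cvg_cst.
  by apply: (freqN (fun i => a (i + m) && b (i + m - k))%N); apply: hd; rewrite -ltnS.
have lcvg : (fun K => `|(\sum_(i < N K)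
        (a (i + m) && b (i + m + m * h)))%N%:R / (N K)%:R - \sum_(k < m.+1) r k *
      ((\sum_(i < N K) (a (i + m) && b (i + m - k)))%N%:R / (N K)%:R)|) @ \oo -->
    `|c - \sum_(k < m.+1) r k * d k|.
  by apply: cvg_norm; exact: cvgB.
pose D k K : R := (\sum_(j < 3 ^ K) (gap_sum j m == k))%N%:R / (3 ^ K)%:R.
have Dcvg : (fun K => \sum_(k < m.+1) `|D k K - r k|) @ \oo -->
    \sum_(k < m.+1) (0 : R).
  apply: cvg_finsum => k; rewrite -(normr0 R) -(subrr (r k)).
  by apply: cvg_norm; apply: cvgB; [exact: rho_frequency|exact: cvg_cst].
pose q : R := ((m + l).+1 * m.+2)%N%:R / h%:R.
have rcvg : (fun K => q + \sum_(k < m.+1) `|D k K - r k|) @ \oo --> q.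
  rewrite -[q in X in _ --> X]addr0; apply: cvgD; first exact: cvg_cst.
  by rewrite big1 in Dcvg.
apply: (ler_cvg_to lcvg rcvg); near=> K.
rewrite /q.
have J_gt0 : 0 < (3 ^ K)%:R :> R by rewrite ltr0n expn_gt0.
have := count_shifted_block m (3 ^ K) ha hb r01; rewrite -/h -/(N K).
set X := (X in `|X%:R - _|); set B := (_ * _)%N => H.
have -> : X%:R / (N K)%:R - \sum_(k < m.+1) r k *
    ((\sum_(i < N K) (a (i + m) && b (i + m - k)))%N%:R / (N K)%:R) =
  (X%:R - \sum_(k < m.+1) r k *
     (\sum_(i < N K) (a (i + m) && b (i + m - k)))%N%:R) / (N K)%:R.
  by rewrite mulrBl mulr_suml; under [in RHS]eq_bigr do rewrite -mulrA.
rewrite normrM [`|_^-1|]ger0_norm ?invr_ge0 ?(ltW (N_gt0 K))// ler_pdivrMr//.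
apply: le_trans H _.
have -> : \sum_(k < m.+1)
    `|(\sum_(j < 3 ^ K) (gap_sum j m == k))%:R - r k * (3 ^ K)%:R| =
    (3 ^ K)%:R * \sum_(k < m.+1) `|D k K - r k|.
  rewrite mulr_sumr; apply: eq_bigr => k _.
  rewrite -{2}(ger0_norm (ltW J_gt0)) -normrM mulrBr /D mulrCA divff ?gt_eqF//.
  by rewrite mulr1 [_ * r k]mulrC.
set s := \sum_(k < m.+1) _.
have s0 : 0 <= s by apply: sumr_ge0.
(* Both errors are written as multiples of 3^K h, which [NJ] bounds by the prefix length. *)
have -> : (3 ^ K)%:R * B%:R + h%:R * ((3 ^ K)%:R * s) =
    (B%:R / h%:R + s) * (3 ^ K * h)%N%:R.
  by rewrite natrM; field; rewrite gt_eqF.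
by rewrite ler_wpM2l ?addr_ge0 ?divr_ge0 ?ler_nat// ltW.
Unshelve. all: by end_near. Qed.

(** * Real square-integrable functions *)

Section square_integrable.
Context d (T : measurableType d) (R : realType) (mu : probability T R).
Implicit Types F G H : T -> R.

Definition sqint F : Prop :=
  measurable_fun setT F /\ mu.-integrable setT (EFin \o (fun x => F x ^+ 2)).

Definition pairing F G : R := \int[mu]_x (F x * G x).

Lemma sqint_mul F G : sqint F -> sqint G ->
  mu.-integrable setT (EFin \o (fun x => F x * G x)).
Proof.
move=> [mF iF] [mG iG].
apply: le_integrable (integrableD measurableT iF iG) => //.
  exact/measurable_EFinP/measurable_funM.
move=> x _ /=; rewrite lee_fin [leRHS]ger0_norm ?addr_ge0 ?sqr_ge0//.
rewrite ler_norml; nra.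
Qed.

Lemma sqint_lin F G (c : R) : sqint F -> sqint G -> sqint (fun x => F x + c * G x).
Proof.
move=> sF sG; have [[mF iF] [mG iG]] := (sF, sG).
have mcG : measurable_fun setT (fun x => c * G x) by exact: measurable_funM.
split; first exact: measurable_funD.
have iFG := sqint_mul sF sG.
rewrite (_ : _ \o _ = ((EFin \o (fun x => F x ^+ 2)%R) \+
    (fun x => (2 * c)%:E * (EFin \o (fun x => F x * G x)%R) x) \+
    (fun x => (c ^+ 2)%:E * (EFin \o (fun x => G x ^+ 2)%R) x))%E); last first.
  apply/funext => x /=; rewrite -!EFinM -!EFinD; congr _%:E; ring.
apply: integrableD => //; last exact: integrableZl.
by apply: integrableD => //; exact: integrableZl.
Qed.

Lemma sqint_indic (A : set T) : measurable A -> sqint \1_A.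
Proof.
move=> mA; split=> //; rewrite (_ : _ \o _ = EFin \o \1_A); last first.
  apply/funext => x /=.
  by rewrite indicE; case: (_ \in _); rewrite ?expr1n ?expr0n.
exact: integrable_indic.
Qed.

Lemma pairingC F G : pairing F G = pairing G F.
Proof. by apply: eq_Rintegral => x _; rewrite mulrC. Qed.

Lemma pairing_linl F G H (c : R) : sqint F -> sqint G -> sqint H ->
  pairing (fun x => F x + c * G x) H = pairing F H + c * pairing G H.
Proof.
move=> sF sG sH; rewrite /pairing.
have iFH := sqint_mul sF sH; have iGH := sqint_mul sG sH.
rewrite -(RintegralZl c measurableT iGH) -RintegralD//; last first.
  rewrite (_ : _ \o _ = (fun x => c%:E * (EFin \o (fun x => G x * H x)%R) x)%E).
    exact: integrableZl.
  by apply/funext => x /=; rewrite EFinM.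
by apply: eq_Rintegral => x _; ring.
Qed.

Lemma pairing_ge0 F : 0 <= pairing F F.
Proof. by apply: Rintegral_ge0 => x _; rewrite -expr2 sqr_ge0. Qed.

(** A weighted arithmetic-geometric inequality, integrated pointwise. Leaving e free lets a small
    [<F,F>] be traded against a merely bounded [<G,G>]. *)
Lemma pairing_bound F G (e : R) : sqint F -> sqint G -> 0 < e ->
  `|pairing F G| <= e^-1 * pairing F F + e * pairing G G.
Proof.
move=> sF sG e0; have iFG := sqint_mul sF sG.
apply: le_trans (le_normr_Rintegral measurableT iFG) _.
have iFF := sqint_mul sF sF; have iGG := sqint_mul sG sG.
have iZ c H : mu.-integrable setT (EFin \o H) ->
    mu.-integrable setT (EFin \o (fun x => c * H x)).
  move=> iH; rewrite (_ : _ \o _ = (fun x => c%:E * (EFin \o H) x)%E).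
    exact: integrableZl.
  by apply/funext => x /=; rewrite EFinM.
rewrite /pairing -(RintegralZl _ measurableT iFF) -(RintegralZl _ measurableT iGG).
rewrite -RintegralD//; [|exact: iZ|exact: iZ].
apply: le_Rintegral => //.
- exact: integrable_norm.
- rewrite (_ : _ \o _ = ((EFin \o (fun x => e^-1 * (F x * F x))%R) \+
      (EFin \o (fun x => e * (G x * G x))%R))%E)//.
  by apply: integrableD => //; exact: iZ.
move=> x _; rewrite normrM -[F x * F x]expr2 -[G x * G x]expr2.
rewrite -(real_normK (num_real (F x))) -(real_normK (num_real (G x))).
set u := `|F x|; set v := `|G x|.
have u0 : 0 <= u by exact: normr_ge0.
have v0 : 0 <= v by exact: normr_ge0.
rewrite -(ler_pM2l e0) mulrDr mulVKf ?gt_eqF//.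
(* The square gives 2euv <= u^2 + e^2 v^2, and nonnegativity of euv allows the factor 2 to be
   dropped. *)
have := sqr_ge0 (u - e * v); have : 0 <= e * (u * v) by rewrite !mulr_ge0// ltW.
rewrite !expr2; nra.
Qed.

End square_integrable.

Import HBNNSimple.

(** * Extending a property from a pi-system to all square-integrable functions *)

Section square_integrable_induction.
Context d (T : measurableType d) (R : realType) (mu : probability T R).
Implicit Types F G H : T -> R.

Variables (S : set (set T)) (Q : (T -> R) -> Prop).
Hypotheses (SI : setI_closed S) (Sm : S `<=` measurable)
  (mS : measurable `<=` <<s S >>) (ST : S setT).
Hypothesis QS : forall A, S A -> Q \1_A.
Hypothesis Qlin : forall F G c, sqint mu F -> sqint mu G -> Q F -> Q G ->
  Q (fun x => F x + c * G x).
Hypothesis Qclosed : forall F, sqint mu F ->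
  (forall e, 0 < e -> exists G, [/\ sqint mu G, Q G &
    \int[mu]_x ((F x - G x) ^+ 2) <= e]) -> Q F.

(** Dynkin class argument: proper differences come from linearity with coefficient -1, and
    increasing unions from closedness, since the squared distance of the indicators of [F n] and of
    the union is the measure of the difference set. *)
Let Q_indic A : measurable A -> Q \1_A.
Proof.
suff : lambda_system setT [set A | measurable A /\ Q \1_A].
  move=> HL mA; have [] // := @lambda_system_subset _ S SI setT _ HL _ _ A.
  - by move=> B SB; split; [exact: Sm|exact: QS].
  - exact: mS.
split=> //; first by split=> //; exact: QS.
- move=> B C CB [mB QB] [mC QC]; split; first exact: measurableD.
  rewrite (_ : \1_(B `\` C) = fun x => \1_B x + -1 * \1_C x).
    by apply: Qlin => //; exact: sqint_indic.
  apply/funext => x; rewrite !indicE mulN1r in_setD.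
  have [xC|] := boolP (x \in C); last by rewrite andbT subr0.
  by rewrite andbF (_ : x \in B) ?subrr//; move: xC; rewrite !inE; exact: CB.
move=> F ndF HF; have mF n : measurable (F n) by have [] := HF n.
have mU : measurable (\bigcup_n F n) by exact: bigcupT_measurable.
split=> //; apply: Qclosed => [|e e0]; first exact: sqint_indic.
have : mu (F n) @[n --> \oo] --> mu (\bigcup_n F n).
  exact: nondecreasing_cvg_mu.
rewrite -[mu (\bigcup_n F n)]fineK ?fin_num_measure//.
move=> /fine_cvgP[_ /cvgrPdist_le /(_ e e0)] [n _ /(_ n (leqnn n))] /= ne.
exists \1_(F n); split; [exact: sqint_indic|by have [] := HF n|].
have FU : F n `<=` \bigcup_n F n by exact: bigcup_sup.
have -> : \int[mu]_x ((\1_(\bigcup_n F n) x - \1_(F n) x) ^+ 2) =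
    fine (mu (\bigcup_n F n `\` F n)).
  rewrite /Rintegral -[in RHS](setIT (_ `\` _)) -integral_indic//; last first.
    exact: measurableD.
  congr fine; apply: eq_integral => x _; congr (_%:E); rewrite !indicE in_setD.
  have [xF|] := boolP (x \in F n); last first.
    by rewrite andbT subr0; case: (_ \in _); rewrite ?expr1n ?expr0n.
  rewrite andbF (_ : x \in \bigcup_n F n) ?subrr ?expr0n//.
  by move: xF; rewrite !inE; exact: FU.
rewrite measureD//; last by rewrite -ge0_fin_numE ?fin_num_measure.
have -> : \bigcup_n F n `&` F n = F n by apply/setIidPr.
rewrite fineB ?fin_num_measure//.
by apply: le_trans ne; exact: ler_norm.
Qed.

Let Q_nnsfun (f : {nnsfun T >-> R}) : Q f.
Proof.
pose g r x : R := \sum_(y <- r) y * \1_(f @^-1` [set y]) x.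
have -> : (f : T -> R) = g (finmap.enum_fset (fset_set (range f))).
  by apply/funext => x; rewrite fimfunE fsbig_finite.
have mI y : measurable (f @^-1` [set y]) by [].
suff gs s : sqint mu (g s) /\ Q (g s) by have [] := gs (finmap.enum_fset (fset_set (range f))).
have s0 : sqint mu \1_(@set0 T) by exact: sqint_indic.
elim: s => [|y s [sIs QIs]].
  rewrite (_ : g [::] = \1_(@set0 T)); first by split=> //; exact: Q_indic.
  by apply/funext => x; rewrite /g big_nil indic0.
have sy : sqint mu \1_(f @^-1` [set y]) by exact: sqint_indic.
rewrite (_ : g (y :: s) = fun x => g s x + y * \1_(f @^-1` [set y]) x).
  by split; [exact: sqint_lin|apply: Qlin => //; exact: Q_indic].
by apply/funext => x; rewrite /g big_cons addrC.
Qed.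

(** The simple approximations satisfy 0 <= f_n <= F, so [(F - f_n)^2] is dominated by [F^2], and
    dominated convergence gives approximation in L^2. *)
Let Q_ge0 F : (forall x, 0 <= F x) -> sqint mu F -> Q F.
Proof.
move=> F0 [mF iF]; apply: Qclosed => // e e0.
have mEF : measurable_fun setT (EFin \o F) by exact/measurable_EFinP.
pose f_ n := nnsfun_approx measurableT mEF n.
have fF n x : f_ n x <= F x.
  rewrite -lee_fin /f_ nnsfun_approxE. 
  by apply: le_approx => // y _; rewrite lee_fin.
have fc x : (fun n => f_ n x) @ \oo --> F x.
  have := @cvg_nnsfun_approx _ _ _ _ measurableT _ mEF (fun y _ => F0 y) x Logic.I.
  by move=> /fine_cvgP[].
have f0 n x : 0 <= f_ n x by [].
have mfn n : measurable_fun setT (f_ n) by [].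
have mD n : measurable_fun setT (fun x => (F x - f_ n x) ^+ 2).
  by apply: measurable_funX; exact: measurable_funB.
have lD n x : (F x - f_ n x) ^+ 2 <= F x ^+ 2.
  have := f0 n x; have := fF n x; rewrite !expr2; nra.
have iD n : mu.-integrable setT (EFin \o (fun x => (F x - f_ n x) ^+ 2)).
  apply: le_integrable iF => //; first exact/measurable_EFinP.
  by move=> x _; rewrite lee_fin !ger0_norm ?sqr_ge0//; exact: lD.
have [||||| _ _] := @dominated_convergence _ _ _ mu setT measurableT
  (fun n x => ((F x - f_ n x) ^+ 2)%:E) (cst 0%E) (EFin \o (fun x => F x ^+ 2)).
- by move=> n; exact/measurable_EFinP.
- exact: measurable_cst.
- apply: aeW => x _; apply: cvg_EFin; first by near=> n.
  have : (fun n => (F x - f_ n x) ^+ 2) @ \oo --> (F x - F x) ^+ 2.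
    by apply: cvgM; apply: cvgB; try exact: cvg_cst; exact: fc.
  by rewrite subrr expr0n.
- exact: iF.
- apply: aeW => x n _ /=; rewrite lee_fin ger0_norm ?sqr_ge0//; exact: lD.
rewrite integral_cst// mul0e => /fine_cvgP[_ /cvgrPdist_le /(_ e e0)].
move=> [n _ /(_ n (leqnn n))]; rewrite /= sub0r normrN => ne.
exists (f_ n); split.
- by split=> //; apply: le_integrable iF => //;
    [exact/measurable_EFinP/measurable_funX|move=> x _ /=];
    rewrite lee_fin !ger0_norm ?sqr_ge0// ler_pXn2r ?nnegrE//; exact: fF.
- exact: Q_nnsfun.
- by apply: le_trans ne; exact: ler_norm.
Unshelve. all: by end_near. Qed.

Lemma sqint_ind F : sqint mu F -> Q F.
Proof.
move=> [mF iF].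
(* The values e = 1 and e = -1 treat the positive and the negative part at once. *)
have sF (e : R) : `|e| = 1 -> sqint mu (fun x => Num.max (e * F x) 0).
  move=> e1; have me : measurable_fun setT (fun x => Num.max (e * F x) 0).
    by apply: measurable_maxr => //; exact: measurable_funM.
  split=> //; apply: le_integrable iF => //.
    by apply/measurable_EFinP/measurable_funX.
  move=> x _; rewrite lee_fin !ger0_norm ?sqr_ge0//.
  rewrite -[leRHS]mul1r -(expr1n _ 2) -e1 -normrX ger0_norm ?sqr_ge0// -exprMn.
  by rewrite /Num.max; case: ifP => _ //; rewrite expr0n sqr_ge0.
have e1 : `|1| = 1 :> R by rewrite normr1.
have eN1 : `|-1| = 1 :> R by rewrite normrN1.
rewrite (_ : F = fun x => Num.max (1 * F x) 0 + -1 * Num.max (-1 * F x) 0).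
  by apply: Qlin; try exact: sF; apply: Q_ge0; try exact: sF;
     move=> x; rewrite le_max lexx orbT.
apply/funext => x; rewrite mul1r !mulN1r.
by rewrite /Num.max; case: ltP => ?; case: ltP => ?; lra.
Qed.

End square_integrable_induction.

Section measure_preserving.
Context d (T : measurableType d) (R : realType) (mu : probability T R).
Variables (phi : T -> T) (mphi : measurable_fun setT phi).
Hypothesis phi_mu : forall A, measurable A -> mu (phi @^-1` A) = mu A.

Let ge0_integral_comp (F : T -> \bar R) : measurable_fun setT F ->
  (forall x, 0 <= F x)%E -> (\int[mu]_x F (phi x) = \int[mu]_x F x)%E.
Proof.
move=> mF F0; rewrite -[RHS](@eq_measure_integral _ _ _ setT _
  (pushforward mu phi : {measure set _ -> \bar R})) => [|A mA _]; last exact: phi_mu.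
by rewrite ge0_integral_pushforward.
Qed.

Lemma sqint_comp F : sqint mu F -> sqint mu (F \o phi).
Proof.
move=> [mF /integrableP[_ iF]]; have mFphi := measurableT_comp mF mphi.
split=> //; apply/integrableP; split.
  exact/measurable_EFinP/measurable_funX.
rewrite (ge0_integral_comp (F := fun x => `|(F x ^+ 2)%:E|%E))//.
by apply: measurableT_comp => //; exact/measurable_EFinP/measurable_funX.
Qed.

Lemma pairing_comp F : sqint mu F -> pairing mu (F \o phi) (F \o phi) = pairing mu F F.
Proof.
move=> [mF _]; rewrite /pairing /Rintegral; congr fine.
rewrite (ge0_integral_comp (F := fun x => (F x * F x)%:E))//.
  exact/measurable_EFinP/measurable_funM.
by move=> x; rewrite lee_fin -expr2 sqr_ge0.
Qed.

End measure_preserving.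

Section vanishing.
Context d (T : measurableType d) (R : realType) (mu : probability T R).
Implicit Types F G H : T -> R.

Lemma pairing_indic (A B : set T) : measurable A -> measurable B ->
  pairing mu \1_A \1_B = fine (mu (A `&` B)).
Proof.
move=> mA mB; rewrite /pairing /Rintegral -[in RHS](setIT (A `&` B)).
rewrite -integral_indic//; last exact: measurableI.
congr fine; apply: eq_integral => x _; congr (_%:E).
by rewrite !indicE in_setI; case: (x \in A); case: (x \in B);
  rewrite ?mulr1 ?mulr0 ?mul0r.
Qed.

Lemma pairing_sum (n : nat) (r : nat -> R) (F : nat -> T -> R) G :
  (forall k, sqint mu (F k)) -> sqint mu G ->
  sqint mu (fun x => \sum_(k < n) r k * F k x) /\
  pairing mu (fun x => \sum_(k < n) r k * F k x) G =
    \sum_(k < n) r k * pairing mu (F k) G.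
Proof.
move=> sF sG; elim: n => [|n [sn pn]].
  have -> : (fun x => \sum_(k < 0) r k * F k x) = \1_(@set0 T).
    by apply/funext => x; rewrite big_ord0 indic0.
  split; first exact: sqint_indic.
  rewrite big_ord0 /pairing (_ : (fun x => _) = cst 0); last first.
    by apply/funext => x; rewrite indic0 mul0r.
  exact: etrans (Rintegral_cst mu measurableT 0) (mul0r _).
have -> : (fun x => \sum_(k < n.+1) r k * F k x) =
    (fun x => \sum_(k < n) r k * F k x + r n * F n x).
  by apply/funext => x; rewrite big_ord_recr.
by split; [exact: sqint_lin|rewrite pairing_linl// pn big_ord_recr].
Qed.

(** The hypothesis with free e says that the functionals are bounded on L^2 uniformly in n; B stands
    for the squared norm of a fixed second argument. Uniformity makes the class of F with [L n F]
    tending to 0 closed, so that [sqint_ind] applies. *)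
Lemma sqint_vanishing (S : set (set T)) (L : nat -> (T -> R) -> R) (K B : R) :
  setI_closed S -> S `<=` measurable -> measurable `<=` <<s S >> -> S setT ->
  0 < K -> 0 < B ->
  (forall n F G c, sqint mu F -> sqint mu G ->
    L n (fun x => F x + c * G x) = L n F + c * L n G) ->
  (forall n F e, sqint mu F -> 0 < e ->
    `|L n F| <= K * (e^-1 * pairing mu F F + e * B)) ->
  (forall A, S A -> (fun n => L n \1_A) @ \oo --> (0 : R)) ->
  forall F, sqint mu F -> (fun n => L n F) @ \oo --> (0 : R).
Proof.
move=> SI Sm mS ST K0 B0 Llin Lbound LS.
apply: (@sqint_ind _ _ _ mu S (fun F => (fun n => L n F) @ \oo --> (0 : R))) => //.
  move=> F G c sF sG LF LG; under eq_fun do rewrite Llin//.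
  have -> : (0 : R) = 0 + c * 0 by rewrite mulr0 addr0.
  by apply: cvgD => //; apply: cvgM => //; exact: cvg_cst.
move=> F sF FG; apply/cvgrPdist_le => e e0.
(* This choice balances the two halves of the bound on L n (F - G). *)
pose delta := e / (4 * K * B).
have delta0 : 0 < delta by rewrite divr_gt0// !mulr_gt0.
have [|G [sG LG FGe]] := FG (delta * (e / (4 * K))).
  by rewrite mulr_gt0// divr_gt0// mulr_gt0.
have sD : sqint mu (fun x => F x + -1 * G x) by exact: sqint_lin.
have FE : F = (fun x => G x + 1 * (F x + -1 * G x)).
  by apply/funext => x; ring.
have pD : pairing mu (fun x => F x + -1 * G x) (fun x => F x + -1 * G x) <=
    delta * (e / (4 * K)).
  apply: le_trans FGe; rewrite le_eqVlt; apply/orP; left; apply/eqP.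
  by apply: eq_Rintegral => x _; ring.
have e2 : 0 < e / 2 by rewrite divr_gt0.
move/cvgrPdist_le : LG => /(_ _ e2) LGe; near=> n.
rewrite sub0r normrN {1}FE Llin// mul1r.
apply: le_trans (ler_normD _ _) _.
have -> : e = e / 2 + e / 2 by lra.
apply: lerD.
  have : `|0 - L n G| <= e / 2 by near: n.
  by rewrite sub0r normrN.
apply: le_trans (Lbound n _ _ sD delta0) _.
have -> : e / 2 = K * (delta^-1 * (delta * (e / (4 * K))) + delta * B).
  by rewrite /delta; field; rewrite !gt_eqF.
by rewrite ler_pM2l// lerD2r ler_pM2l// invr_gt0.
Unshelve. all: by end_near. Qed.

End vanishing.

(** * Finite windows *)

Definition window_set (i : int) (l : nat) (P : pred (seq bool)) :
  set chacon_space := [set x | P (subword (val x) i l)].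

Lemma nbhs_subword (x : full_shift) (i : int) (l : nat) :
  nbhs x [set z : full_shift | subword z i l = subword x i l].
Proof.
suff : nbhs x [set z : full_shift | forall j, (j < l)%N -> z (i + j%:Z) = x (i + j%:Z)].
  apply: filterS => z zx; apply/eq_in_map => j; rewrite mem_iota add0n => /andP[_].
  exact: zx.
elim: l => [|l IHl]; first by apply: filterS filterT.
have xl : nbhs x ((fun z : full_shift => z (i + l%:Z)) @^-1` [set x (i + l%:Z)]).
  apply: (@proj_continuous _ (fun=> bool) (i + l%:Z) x).
  exact: discrete_set1.
apply: filterS (filterI IHl xl) => z [/= zx zl] j.
by rewrite ltnS leq_eqVlt => /predU1P[->//|/zx].
Qed.

Lemma eq_subword (x z : full_shift) i l j :
  subword z i l = subword x i l -> (j < l)%N -> z (i + j%:Z) = x (i + j%:Z).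
Proof.
move=> zx jl; have := congr1 (nth false ^~ j) zx.
by rewrite /subword !nth_mkseq.
Qed.

(** The sets containing all points that agree with x on some central window form a filter. It
    converges to x in each coordinate, hence in the product topology, so it contains every
    neighbourhood of x. *)
Lemma nbhs_full_shift (x : full_shift) (U : set full_shift) : nbhs x U ->
  exists n : nat, forall z, subword z (- n%:Z) n.*2.+1 = subword x (- n%:Z) n.*2.+1 ->
    U z.
Proof.
pose F : set_system full_shift := [set V | exists n : nat, forall z : full_shift,
  subword z (- n%:Z) n.*2.+1 = subword x (- n%:Z) n.*2.+1 -> V z].
have mono n m (z : full_shift) : (n <= m)%N ->
    subword z (- m%:Z) m.*2.+1 = subword x (- m%:Z) m.*2.+1 ->
    subword z (- n%:Z) n.*2.+1 = subword x (- n%:Z) n.*2.+1.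
  move=> nm zx; apply/eq_in_map => j; rewrite mem_iota add0n => /andP[_ jn].
  have -> : - n%:Z + j%:Z = - m%:Z + (m - n + j)%N%:Z by lia.
  by apply: (eq_subword zx); lia.
have FF : Filter F.
  split; first by exists 0%N.
    move=> A B [n nA] [m mB]; exists (maxn n m) => z zx; split.
      exact/nA/(mono _ _ _ (leq_maxl n m) zx).
    exact/mB/(mono _ _ _ (leq_maxr n m) zx).
  by move=> A B AB [n nA]; exists n => z /nA/AB.
suff Fx : F --> x by move=> Ux; exact: (Fx U Ux).
apply/cvg_sup => i V; rewrite nbhsE => -[_ [[B oB <-] Bx] BV].
exists `|i|%N => z zx; apply: BV; move: Bx; rewrite /= (_ : z i = x i)//.
have -> : i = - `|i|%N%:Z + (absz (i + `|i|%N%:Z)%R)%:Z by lia.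
by apply: (eq_subword zx); lia.
Qed.

Lemma window_set_open i l P : open (window_set i l P).
Proof.
exists [set x : full_shift | P (subword x i l)]; last by [].
rewrite openE => x Px; rewrite /interior.
by apply: filterS (nbhs_subword x i l) => z /= ->.
Qed.

Lemma measurable_window_set i l P : measurable (window_set i l P).
Proof. by apply: sub_sigma_algebra; exact: window_set_open. Qed.

(** Arbitrary predicates instead of single words make the class contain the whole space and allow
    two windows to be widened to a common size, which gives closure under intersection. *)
Definition window_sets : set (set chacon_space) :=
  [set A | exists (n : nat) P, A = window_set (- n%:Z) n.*2.+1 P].

Lemma take_drop_mkseq T (f : nat -> T) j k l : (j + k <= l)%N ->
  take k (drop j (mkseq f l)) = mkseq (fun t => f (j + t)%N) k.
Proof.
move=> jkl; rewrite /mkseq -map_drop -map_take drop_iota take_iota.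
rewrite (minn_idPl _); last by lia.
by rewrite add0n -[j in iota j]addn0 iotaDl -map_comp.
Qed.

Lemma subword_take_drop (x : full_shift) (i : int) l j k : (j + k <= l)%N ->
  take k (drop j (subword x i l)) = subword x (i + j%:Z) k.
Proof.
move=> jkl; rewrite take_drop_mkseq//.
by apply: eq_mkseq => t; rewrite PoszD addrA.
Qed.

Lemma window_set_widen n m P : (n <= m)%N ->
  window_set (- n%:Z) n.*2.+1 P = window_set (- m%:Z) m.*2.+1
    (fun s => P (take n.*2.+1 (drop (m - n) s))).
Proof.
move=> nm; have mn : (m - n + n.*2.+1 <= m.*2.+1)%N by lia.
have E : - m%:Z + (m - n)%N%:Z = - n%:Z by lia.
have sE x := subword_take_drop (val x) (- m%:Z) mn.
by apply/seteqP; split=> x; rewrite /window_set /= sE E.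
Qed.

Lemma window_sets_setI : setI_closed window_sets.
Proof.
move=> _ _ [n [P ->]] [m [Q ->]]; exists (maxn n m).
rewrite (window_set_widen P (leq_maxl n m)) (window_set_widen Q (leq_maxr n m)).
exists (fun s => P (take n.*2.+1 (drop (maxn n m - n) s)) &&
  Q (take m.*2.+1 (drop (maxn n m - m) s))).
by apply/seteqP; split=> x; rewrite /window_set /= => /andP.
Qed.

Lemma window_sets_generate : measurable `<=` <<s window_sets >>.
Proof.
apply: smallest_sub; first exact: smallest_sigma_algebra.
move=> _ [B oB <-].
(* Selects the central words whose cylinder lies inside B; the open set B is the countable union of
   these cylinders over n. *)
pose P n s := `[< forall z : full_shift, subword z (- n%:Z) n.*2.+1 = s -> B z >].
have -> : val @^-1` B = \bigcup_n window_set (- n%:Z) n.*2.+1 (P n).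
  apply/seteqP; split=> x /=; last by move=> [n _ /asboolP]; apply.
  move: oB; rewrite openE => oB /oB/nbhs_full_shift[n nB].
  by exists n => //; apply/asboolP => z /nB.
apply: sigma_algebra_bigcup => n; apply: sub_sigma_algebra.
by exists n, (P n).
Qed.

Lemma subword_shift_by k (x : full_shift) i l :
  subword (shift_by k x) i l = subword x (i + k) l.
Proof. by apply: eq_mkseq => j; rewrite /shift_by addrAC. Qed.

Section chacon_measure.
Context {R : realType} (mu : probability chacon_space R)
  (mu_chacon : chacon_measure mu).

Lemma shift_X_add j k x : shift_X (j + k) x = shift_X j (shift_X k x).
Proof.
by apply: val_inj; apply: funext => i; rewrite /= /shift_by addrA.
Qed.

Lemma chacon_measure_shift k A : measurable A -> mu (shift_X k @^-1` A) = mu A.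
Proof.
have mS j B : measurable B -> measurable (shift_X j @^-1` B).
  by move=> mB; rewrite -[X in measurable X]setTI; exact: measurable_shift_X.
have natP (n : nat) B : measurable B -> mu (shift_X n%:Z @^-1` B) = mu B.
  move=> mB; elim: n => [|n IHn].
    congr (mu _); apply/seteqP.
    by split=> x /=; rewrite (_ : shift_X 0 x = x)//;
      apply: val_inj; apply: funext => i; rewrite /= /shift_by addr0.
  rewrite -[in LHS]addn1 PoszD -IHn -[RHS](proj1 mu_chacon); last exact: mS.
  by congr (mu _); apply/seteqP; split=> x /=; rewrite shift_X_add.
move=> mA; case: k => n; first exact: natP.
rewrite -[LHS](natP n.+1); last exact: mS.
by congr (mu _); apply/seteqP; split=> x /=; rewrite NegzE shift_XK.
Qed.

Lemma mu_window_set_pair_shift i j k l P Q :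
  mu (window_set (i + k) l P `&` window_set (j + k) l Q) =
  mu (window_set i l P `&` window_set j l Q).
Proof.
rewrite -[RHS](chacon_measure_shift k); last first.
  by apply: measurableI; exact: measurable_window_set.
by congr (mu _); apply/seteqP; split=> x; rewrite /window_set /= !subword_shift_by.
Qed.

(** A window event is a finite disjoint union of cylinders over the words of length l, whose
    frequencies are given by [chacon_measure]. *)
Lemma window_set_frequency l P :
  has_frequency (fun i => P (inf_window l i)) (fine (mu (window_set 0 l P))).
Proof.
have cE (u : l.-tuple bool) : cylinder u = window_set 0 l (pred1 (u : seq bool)).
  by apply/seteqP; split=> x; rewrite /cylinder /window_set /= size_tuple => /eqP.
rewrite (fine_probability_partition mu (F := fun u : l.-tuple bool => cylinder u)).
- have uE (u : l.-tuple bool) : fine (mu (window_set 0 l P `&` cylinder u)) =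
      (P u)%:R * fine (mu (cylinder u)).
    rewrite cE; have [Pu|Pu] := boolP (P u).
      rewrite mul1r; congr (fine (mu _)); apply/seteqP; split=> [x []//|x xu].
      by split=> //; rewrite /window_set /= (eqP xu).
    rewrite mul0r (_ : _ `&` _ = set0) ?measure0//.
    by rewrite -subset0 => x [+ /eqP xu]; rewrite /window_set /= xu (negPf Pu).
  under eq_bigr do rewrite uE.
  rewrite /has_frequency (_ : (fun N => _) = (fun N => \sum_(u : l.-tuple bool)
     (P u)%:R * ((\sum_(i < N) occurs_at u i)%N%:R / N%:R))).
    apply: cvg_finsum => u; apply: cvgM; first exact: cvg_cst.
    exact: (proj2 mu_chacon).
  apply/funext => N; under [RHS]eq_bigr do rewrite mulrA -natrM.
  rewrite -mulr_suml -natr_sum; congr (_%:R / _).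
  under [RHS]eq_bigr do rewrite big_distrr.
  rewrite exchange_big /=; apply: eq_bigr => i _.
  pose w : l.-tuple bool := [tuple of inf_window l i].
  rewrite (bigD1 w)//= big1 ?addn0 => [|u uw].
    by rewrite /occurs_at size_mkseq eqxx muln1.
  rewrite (_ : occurs_at u i = false) ?muln0//; apply/negbTE.
  apply: contraNN uw; rewrite /occurs_at size_tuple => /eqP wu.
  by apply/eqP/val_inj.
- exact: measurable_window_set.
- by move=> u; rewrite cE; exact: measurable_window_set.
- move=> u v _ _ [x []]; rewrite !cE /window_set /= => /eqP xu /eqP xv.
  by apply/val_inj; rewrite /= -xu -xv.
- move=> x; exists [tuple of subword (val x) 0 l].
  by rewrite cE /window_set /= eqxx.
Qed.

(** Both windows are read inside one window of length i + j + l, which turns the joint event into a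
    single window event. *)
Lemma window_set_pair_frequency l P Q (i j : nat) :
  has_frequency (fun s => P (inf_window l (s + i)) && Q (inf_window l (s + j)))
    (fine (mu (window_set i%:Z l P `&` window_set j%:Z l Q))).
Proof.
have ki : (i + l <= i + j + l)%N by lia.
have kj : (j + l <= i + j + l)%N by lia.
have := @window_set_frequency (i + j + l)
  (fun s => P (take l (drop i s)) && Q (take l (drop j s))).
rewrite (_ : window_set 0 _ _ = window_set i%:Z l P `&` window_set j%:Z l Q).
  move=> H; rewrite (_ : (fun s => _) = (fun s => P (take l (drop i (inf_window (i + j + l) s))) &&
    Q (take l (drop j (inf_window (i + j + l) s)))))//.
  apply/funext => s; rewrite /inf_window (take_drop_mkseq _ ki) (take_drop_mkseq _ kj).
  by congr (P _ && Q _); apply: eq_mkseq => t; rewrite addnA.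
apply/seteqP; split=> x; rewrite /window_set /= (subword_take_drop _ _ ki) (subword_take_drop _ _ kj) !add0r.
  by move=> /andP.
by move=> [-> ->].
Qed.

End chacon_measure.

(** * The weak limit *)

Lemma iter_shift_X j n x : iter n (shift_X j) x = shift_X (n%:Z * j) x.
Proof.
elim: n => [|n IHn].
  by apply: val_inj; apply: funext => i; rewrite /= /shift_by mul0r addr0.
by rewrite iterS IHn -shift_X_add; congr (shift_X _ _); lia.
Qed.

Lemma koopman_expE (R : realType) k (f : chacon_space -> R[i]) x :
  koopman_exp k f x = f (shift_X k x).
Proof.
have itE (T : Type) (phi : T -> T) (g : T -> R[i]) n y :
    iter n (fun h => h \o phi) g y = g (iter n phi y).
  elim: n y => [//|n IHn] y.
  by rewrite iterS /= IHn -iterSr.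
case: k => n; rewrite /koopman_exp.
  by rewrite (itE _ chacon_T) iter_shift_X mulr1.
by rewrite (itE _ chacon_Tinv) iter_shift_X mulrN1 NegzE.
Qed.

Section weak_limit.
Context {R : realType} (mu : probability chacon_space R) (nu : probability adic3 R).
Context (mu_chacon : chacon_measure mu) (nu_haar : haar_probability nu) (m : nat).

Let r (k : nat) : R := fine (rho nu m [set k%:Z]).

Lemma sqint_shift k F : sqint mu F -> sqint mu (F \o shift_X k).
Proof.
apply: sqint_comp; first exact: measurable_shift_X.
by move=> A mA; exact: chacon_measure_shift.
Qed.

Lemma pairing_shift k F : sqint mu F ->
  pairing mu (F \o shift_X k) (F \o shift_X k) = pairing mu F F.
Proof.
apply: pairing_comp; first exact: measurable_shift_X.
by move=> A mA; exact: chacon_measure_shift.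
Qed.

Lemma window_set_shift k i l P :
  shift_X k @^-1` window_set i l P = window_set (i + k) l P.
Proof.
by apply/seteqP; split=> x; rewrite /window_set /= subword_shift_by.
Qed.

Definition defect (n : nat) (F G : chacon_space -> R) : R :=
  pairing mu (F \o shift_X (- (m * tower_height n)%N%:Z)) G -
  \sum_(k < m.+1) r k * pairing mu (F \o shift_X k%:Z) G.

(** Invariance moves the first window to coordinate m and the second to m + m h_n or m - k. The
    offset m keeps m - k nonnegative for every k <= m, as the one-sided word requires. *)
Lemma defect_window_sets i l P Q n :
  `|defect n \1_(window_set i l P) \1_(window_set i l Q)| <=
    ((m + l).+1 * m.+2)%N%:R / (tower_height n)%:R.
Proof.
have mW := measurable_window_set.
have pE k : pairing mu (\1_(window_set i l P) \o shift_X k) \1_(window_set i l Q) =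
    fine (mu (window_set (i + k) l P `&` window_set i l Q)).
  rewrite -pairing_indic//; congr pairing; apply/funext => x /=.
  by rewrite -window_set_shift.
have pEnat (k : int) (a b : nat) : i + k + (b%:Z - i) = a%:Z ->
    pairing mu (\1_(window_set i l P) \o shift_X k) \1_(window_set i l Q) =
    fine (mu (window_set a%:Z l P `&` window_set b%:Z l Q)).
  move=> kab; rewrite pE -(mu_window_set_pair_shift mu_chacon _ _ (b%:Z - i)).
  by rewrite kab addrC subrK.
rewrite /defect (pEnat _ m (m + m * tower_height n)%N); last by lia.
rewrite (eq_bigr (fun k : 'I_m.+1 => r k *
    fine (mu (window_set m%:Z l P `&` window_set (m - k)%N%:Z l Q)))); last first.
  by move=> k _; rewrite (pEnat _ m (m - k)%N)//; have := ltn_ord k; lia.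
apply: (@frequency_shifted_block R nu (P \o inf_window l) (Q \o inf_window l)
  l m n _ (fun k => fine (mu (window_set m%:Z l P `&` window_set (m - k)%N%:Z l Q)))) => //.
- by move=> j t tl; rewrite /= inf_window_block.
- by move=> j t tl; rewrite /= inf_window_block.
- have := @window_set_pair_frequency _ _ mu_chacon l P Q m (m + m * tower_height n)%N.
  by under eq_fun do rewrite addnA.
- move=> k km; have := @window_set_pair_frequency _ _ mu_chacon l P Q m (m - k)%N.
  by under eq_fun do rewrite addnBA//.
Qed.

Lemma cvg_inv_tower_height (C : R) : (fun n => C / (tower_height n)%:R) @ \oo --> (0 : R).
Proof.
have hoo : (fun n => (tower_height n)%:R : R) @ \oo --> +oo.
  apply: ger_cvgy cvgr_idn; apply: nearW => n.
  by rewrite ler_nat ltnW// tower_height_gt.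
rewrite -(mulr0 C); apply: cvgM; first exact: cvg_cst.
apply/gtr0_cvgV0 => //; apply: nearW => n.
by rewrite ltr0n (leq_ltn_trans _ (tower_height_gt n)).
Qed.

Lemma defect_linl n F F' G c : sqint mu F -> sqint mu F' -> sqint mu G ->
  defect n (fun x => F x + c * F' x) G = defect n F G + c * defect n F' G.
Proof.
move=> sF sF' sG; rewrite /defect.
have pE k : pairing mu ((fun x => F x + c * F' x) \o shift_X k) G =
    pairing mu (F \o shift_X k) G + c * pairing mu (F' \o shift_X k) G.
  rewrite -pairing_linl//; exact: sqint_shift.
rewrite pE; under eq_bigr do rewrite pE mulrDr mulrCA.
by rewrite big_split /= -mulr_sumr; ring.
Qed.

Lemma defect_linr n F G G' c : sqint mu F -> sqint mu G -> sqint mu G' ->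
  defect n F (fun x => G x + c * G' x) = defect n F G + c * defect n F G'.
Proof.
move=> sF sG sG'; rewrite /defect.
have pE k : pairing mu (F \o shift_X k) (fun x => G x + c * G' x) =
    pairing mu (F \o shift_X k) G + c * pairing mu (F \o shift_X k) G'.
  rewrite pairingC pairing_linl//; last exact: sqint_shift.
  by rewrite pairingC [pairing mu G' _]pairingC.
rewrite pE; under eq_bigr do rewrite pE mulrDr mulrCA.
by rewrite big_split /= -mulr_sumr; ring.
Qed.

Lemma r_ge0 k : 0 <= r k. Proof. by rewrite /r fine_ge0. Qed.

(** Shifts preserve [<F,F>], so all pairings obey the same bound and their weights 1 and [r k] add
    up. The constant is independent of n. *)
Lemma defect_bound n F G e : sqint mu F -> sqint mu G -> 0 < e ->
  `|defect n F G| <= (1 + \sum_(k < m.+1) r k) *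
    (e^-1 * pairing mu F F + e * pairing mu G G).
Proof.
move=> sF sG e0.
have pB k : `|pairing mu (F \o shift_X k) G| <=
    e^-1 * pairing mu F F + e * pairing mu G G.
  rewrite -(pairing_shift k sF); apply: pairing_bound => //; exact: sqint_shift.
rewrite /defect mulrDl mul1r; apply: le_trans (ler_normB _ _) _; apply: lerD => //.
apply: le_trans (ler_norm_sum _ _ _) _; rewrite mulr_suml; apply: ler_sum => k _.
by rewrite normrM ger0_norm ?r_ge0// ler_wpM2l ?r_ge0.
Qed.

(** [sqint_vanishing] is used twice: first in G, with F the indicator of a window set, then in F,
    with G arbitrary. *)
Lemma cvg_defect F G : sqint mu F -> sqint mu G ->
  (fun n => defect n F G) @ \oo --> (0 : R).
Proof.
have Sm : window_sets `<=` measurable.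
  by move=> _ [p [P ->]]; exact: measurable_window_set.
have ST : window_sets setT.
  by exists 0%N, xpredT; apply/seteqP; split.
pose K := 1 + \sum_(k < m.+1) r k.
have K0 : 0 < K by rewrite ltr_pwDl// sumr_ge0// => k _; exact: r_ge0.
have vanish := sqint_vanishing (mu := mu) window_sets_setI Sm window_sets_generate ST K0.
move=> sF; move: F sF G.
have WG A : window_sets A -> forall G, sqint mu G ->
    (fun n => defect n \1_A G) @ \oo --> (0 : R).
  move=> wA; have sA : sqint mu \1_A by apply: sqint_indic; exact: Sm.
  (* The added 1 keeps the constant positive even when the norm is zero. *)
  apply: (vanish (fun n => defect n \1_A) (1 + pairing mu \1_A \1_A)).
  - by rewrite ltr_pwDl// pairing_ge0.
  - by move=> n G G' c; exact: defect_linr.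
  (* The varying function is now the second argument, so the parameter of [defect_bound] is
     inverted. *)
  - move=> n G e sG e0; have e0V : 0 < e^-1 by rewrite invr_gt0.
    apply: le_trans (defect_bound n sA sG e0V) _.
    by rewrite ler_pM2l// invrK addrC lerD2l ler_pM2l// lerDr.
  move=> B wB; case: wA => p [P ->]; case: wB => q [Q ->].
  rewrite (window_set_widen P (leq_maxl p q)) (window_set_widen Q (leq_maxr p q)).
  set i := - _; set l := _.*2.+1; set P' := fun s => P _; set Q' := fun s => Q _.
  apply/cvgrPdist_le => e e0.
  have := cvg_inv_tower_height ((m + l).+1 * m.+2)%N%:R.
  move/cvgrPdist_le => /(_ e e0) he; near=> n.
  rewrite sub0r normrN; apply: le_trans (defect_window_sets _ _ _ _ _) _.
  have : `|0 - ((m + l).+1 * m.+2)%N%:R / (tower_height n)%:R| <= e by near: n.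
  by rewrite sub0r normrN; apply: le_trans; exact: ler_norm.
move=> F sF G sG; move: F sF.
apply: (vanish (fun n F => defect n F G) (1 + pairing mu G G)).
- by rewrite ltr_pwDl// pairing_ge0.
- by move=> n F F' c sF sF'; exact: defect_linl.
- move=> n F e sF e0; apply: le_trans (defect_bound n sF sG e0) _.
  by rewrite ler_pM2l// lerD2l ler_pM2l// lerDr.
by move=> A /WG; exact.
Unshelve. all: by end_near. Qed.

End weak_limit.

(** * Finite form of the limit operator and passage to complex functions *)

Lemma cvg_complex (R : realType) (a b : nat -> R) (x y : R) :
  a @ \oo --> x -> b @ \oo --> y ->
  (fun n => (a n +i* b n)%C : R[i]^o) @ \oo --> ((x +i* y)%C : R[i]^o).
Proof.
move=> /cvgrPdist_le ax /cvgrPdist_le bY; apply/cvgrPdist_le => -[e e'].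
(* A positive element of [R[i]] has zero imaginary part, so the tolerance is a real number. *)
rewrite ltcE /= => /andP[/eqP -> e0].
have e2 : 0 < e / 2 by rewrite divr_gt0.
have {}ax := ax _ e2; have {}bY := bY _ e2; near=> n.
have an : `|x - a n| <= e / 2 by near: n.
have bn : `|y - b n| <= e / 2 by near: n.
rewrite normc_def lecE /= eqxx /=.
move: (x - a n) (y - b n) an bn => u v un vn.
apply: (@le_trans _ _ (`|u| + `|v|)); last by lra.
rewrite -[leRHS]ger0_norm ?addr_ge0// -sqrtr_sqr ler_wsqrtr// sqrrD !real_normK ?num_real//.
by rewrite -addrA lerD2l lerDr mulrn_wge0// mulr_ge0.
Unshelve. all: by end_near. Qed.

Section rho_sum.
Context {R : realType} (nu : probability adic3 R) (m : nat).

Lemma phi0_sum_bounded y : exists2 k : nat, (k <= m)%N & phi0_sum m y = k%:Z.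
Proof.
exists (\sum_(i < m) `[< first_non2_is1 (iter i odometer y) >])%N.
  rewrite -[leqRHS]card_ord -sum1_card leq_sum// => i _; exact: leq_b1.
by rewrite /phi0_sum (big_morph Posz PoszD (erefl _)).
Qed.

Lemma rho_eq0 (A : set int) : (forall k : nat, (k <= m)%N -> ~ A k%:Z) -> rho nu m A = 0%E.
Proof.
move=> Am; rewrite /rho /= /distribution /pushforward.
rewrite (_ : _ @^-1` _ = set0) ?measure0// -subset0 => y /=.
by have [k km ->] := phi0_sum_bounded y; exact: Am.
Qed.

(** The measure charges only 0, ..., m, so h agrees almost everywhere with the combination [h'] of
    indicators of these points, whose integral is computed by linearity. *)
Lemma Rintegral_rho (h : int -> R) : \int[rho nu m]_k h k =
  \sum_(k < m.+1) fine (rho nu m [set k%:Z]) * h k%:Z.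
Proof.
pose h' n (k : int) : R := \sum_(j < n) h j%:Z * \1_[set j%:Z] k.
have h'S n k : h' n.+1 k = h' n k + h n%:Z * \1_[set n%:Z] k.
  by rewrite /h' big_ord_recr.
have iI (j : nat) : (rho nu m).-integrable setT (EFin \o (fun k => h j%:Z * \1_[set j%:Z] k)).
  rewrite (_ : _ \o _ = (fun k => (h j%:Z)%:E * (\1_[set j%:Z] k)%:E)%E).
    by apply: integrableZl => //; exact: integrable_indic.
  by apply/funext => k /=; rewrite EFinM.
have ih n : (rho nu m).-integrable setT (EFin \o h' n).
  elim: n => [|n IHn].
    rewrite (_ : _ \o _ = cst 0%E); first exact: integrable0.
    by apply/funext => k; rewrite /h' /= big_ord0.
  rewrite (_ : _ \o _ = (EFin \o h' n) \+ (EFin \o (fun k => (h n%:Z * \1_[set n%:Z] k)%R)))%E.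
    exact: integrableD.
  by apply/funext => k; rewrite /= h'S EFinD.
have Ih n : \int[rho nu m]_k h' n k =
    \sum_(j < n) fine (rho nu m [set j%:Z]) * h j%:Z.
  elim: n => [|n IHn].
    rewrite big_ord0 (_ : h' 0%N = cst 0); last first.
      by apply/funext => k; rewrite /h' big_ord0.
    exact: etrans (Rintegral_cst _ measurableT 0) (mul0r _).
  rewrite big_ord_recr /= -IHn (_ : h' n.+1 = fun k => h' n k + h n%:Z * \1_[set n%:Z] k); last first.
    by apply/funext => k; rewrite h'S.
  rewrite RintegralD// RintegralZl//; last exact: integrable_indic.
  by rewrite /Rintegral integral_indic// setIT mulrC.
rewrite -Ih /Rintegral; congr fine; apply: ae_eq_integral => //.
exists (~` [set k%:Z | k in [set k : nat | (k <= m)%N]]); split => //.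
  by apply: rho_eq0 => k km; apply; exists k.
move=> k /=; apply: contra_not => -[j jm <-] _; congr (_%:E).
rewrite /h' (bigD1 (Ordinal (jm : j < m.+1)%N))//= indicE mem_set// mulr1.
rewrite big1 ?addr0// => i ij; rewrite indicE memNset ?mulr0//= => -[ji].
by move/eqP: ij; apply; apply/val_inj.
Qed.

Lemma koopman_rhoE (f : chacon_space -> R[i]) x : koopman_rho nu m f x =
  \sum_(k < m.+1) (fine (rho nu m [set k%:Z]))%:C%C * f (shift_X k%:Z x).
Proof.
rewrite /koopman_rho.
rewrite -(@fsbig_widen _ _ _ _ [set` map Posz (iota 0 m.+1)])//.
- rewrite -fsbig_seq; last by rewrite map_inj_uniq ?iota_uniq// => i j [].
  rewrite big_map -[iota _ _]/(index_iota 0 m.+1) big_mkord.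
  by apply: eq_bigr => k _; rewrite koopman_expE.
- move=> k [_ km]; rewrite /preimage /= rho_eq0 ?mul0r// => j jm jk; apply: km.
  have : j%:Z \in [seq i%:Z | i <- iota 0 m.+1] by apply: map_f; rewrite mem_iota.
  by rewrite jk.
Qed.

Lemma koopman_rho_poly : exists P : {poly R[i]}, forall f : chacon_space -> R[i],
  koopman_rho nu m f = koopman_poly P f.
Proof.
pose c k : R[i] := (fine (rho nu m [set k%:Z]))%:C%C.
exists (\poly_(k < m.+1) c k) => f; apply/funext => x.
rewrite koopman_rhoE /koopman_poly.
set P := \poly_(k < m.+1) c k.
(* The size of P can be smaller than [m.+1] because top coefficients may vanish; the missing terms
   are zero. *)
rewrite (big_ord_widen m.+1 (fun j => P`_j * koopman_exp j f x)) ?size_poly//.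
rewrite [RHS]big_mkcond; apply: eq_bigr => k _; rewrite koopman_expE -[_%:C%C]/(c k).
have -> : c k = P`_k by rewrite coef_poly ltn_ord.
by case: ltnP => // kP; rewrite nth_default// mul0r.
Qed.

End rho_sum.

Section complex_L2.
Context d (T : measurableType d) (R : realType) (mu : probability T R).

Definition csqint (f : T -> R[i]) : Prop :=
  sqint mu (@complex.Re R \o f) /\ sqint mu (@complex.Im R \o f).

Lemma L2_csqint f : L2 mu f -> csqint f.
Proof.
move=> [mR mI fi].
have normE x : ComplexField.Normc.normc (f x) ^+ 2 =
    complex.Re (f x) ^+ 2 + complex.Im (f x) ^+ 2.
  by case: (f x) => a b /=; rewrite sqr_sqrtr// addr_ge0// sqr_ge0.
have mR2 := measurable_funX 2 mR; have mI2 := measurable_funX 2 mI.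
have iN : mu.-integrable setT
    (EFin \o (fun x => complex.Re (f x) ^+ 2 + complex.Im (f x) ^+ 2)).
  apply/integrableP; split; first exact/measurable_EFinP/measurable_funD.
  apply: le_lt_trans fi; rewrite le_eqVlt; apply/orP; left; apply/eqP.
  apply: eq_integral => x _ /=.
  by rewrite normE ger0_norm// addr_ge0// sqr_ge0.
by split; split=> //; apply: le_integrable iN => //; try exact/measurable_EFinP;
  move=> x _ /=; rewrite lee_fin !ger0_norm ?addr_ge0 ?sqr_ge0//;
  rewrite ?lerDl ?lerDr sqr_ge0.
Qed.

(** Splits the complex inner product into four real pairings, to each of which [cvg_defect] applies
    separately. *)
Lemma innerE f g : csqint f -> csqint g -> inner mu f g =
  ((pairing mu (@complex.Re R \o f) (@complex.Re R \o g) +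
    pairing mu (@complex.Im R \o f) (@complex.Im R \o g)) +i*
   (pairing mu (@complex.Im R \o f) (@complex.Re R \o g) -
    pairing mu (@complex.Re R \o f) (@complex.Im R \o g)))%C.
Proof.
move=> [fR fI] [gR gI]; rewrite /inner /cintegral /pairing.
rewrite -RintegralD//; try exact: sqint_mul.
rewrite -RintegralB//; try exact: sqint_mul.
by congr (_ +i* _)%C; apply: eq_Rintegral => x _ /=; case: (f x) (g x) => a b [c e] /=; ring.
Qed.

End complex_L2.

Section assembly.
Context {R : realType} (mu : probability chacon_space R) (nu : probability adic3 R).
Context (mu_chacon : chacon_measure mu) (m : nat).
Let r (k : nat) : R := fine (rho nu m [set k%:Z]).

Lemma csqint_koopman_exp k f : csqint mu f -> csqint mu (koopman_exp k f).
Proof.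
move=> [fR fI]; have -> : koopman_exp k f = f \o shift_X k.
  by apply/funext => x; rewrite koopman_expE.
by split; [exact: (sqint_shift mu_chacon k fR)|exact: (sqint_shift mu_chacon k fI)].
Qed.

Lemma koopman_rho_parts f :
  (@complex.Re R \o koopman_rho nu m f = fun x => \sum_(k < m.+1) r k *
    ((@complex.Re R \o f) \o shift_X k%:Z) x) /\
  (@complex.Im R \o koopman_rho nu m f = fun x => \sum_(k < m.+1) r k *
    ((@complex.Im R \o f) \o shift_X k%:Z) x).
Proof.
split; apply/funext => x; rewrite /= koopman_rhoE raddf_sum; apply: eq_bigr => k _ /=.
  by case: (f _) => a b /=; rewrite mul0r subr0.
by case: (f _) => a b /=; rewrite mul0r addr0.
Qed.

Lemma csqint_koopman_rho f : csqint mu f -> csqint mu (koopman_rho nu m f).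
Proof.
move=> [fR fI]; have [ER EI] := koopman_rho_parts f; rewrite /csqint ER EI.
by split; [have sF k := sqint_shift mu_chacon k%:Z fR|have sF k := sqint_shift mu_chacon k%:Z fI];
  have [] := pairing_sum m.+1 r sF fR.
Qed.

End assembly.

Theorem lemma9 (R : realType) (mu : probability chacon_space R)
    (nu : probability adic3 R) (m : nat) :
  chacon_measure mu -> haar_probability nu -> (1 <= m)%N ->
  [/\ weak_cvg mu (fun n => koopman_exp (- (m * tower_height n)%N%:Z))
        (koopman_rho nu m),
      weak_integral mu (rho nu m) koopman_exp (koopman_rho nu m) &
      exists P : {poly R[i]}, forall f : chacon_space -> R[i],
        koopman_rho nu m f = koopman_poly P f].
Proof.
move=> mu_chacon nu_haar _.
pose r (k : nat) : R := fine (rho nu m [set k%:Z]).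
have kE k (f : chacon_space -> R[i]) : koopman_exp k f = f \o shift_X k.
  by apply/funext => x; rewrite koopman_expE.
have sS k F := sqint_shift mu_chacon (F := F) k.
have pS (F G : chacon_space -> R) : sqint mu F -> sqint mu G ->
    pairing mu (fun x => \sum_(k < m.+1) r k * (F \o shift_X k%:Z) x) G =
    \sum_(k < m.+1) r k * pairing mu (F \o shift_X k%:Z) G.
  by move=> sF sG; have [] := pairing_sum m.+1 r (fun k => sS k%:Z F sF) sG.
split; last exact: koopman_rho_poly.
- move=> f g /L2_csqint cf /L2_csqint cg.
  have [[fR fI] [gR gI]] := (cf, cg).
  have ck := csqint_koopman_exp mu_chacon _ cf.
  under eq_fun do rewrite innerE// kE.
  rewrite innerE//; last exact: csqint_koopman_rho.
  have [-> ->] := koopman_rho_parts nu m f; rewrite !pS//.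
  have cvgp F G : sqint mu F -> sqint mu G ->
      (fun n => pairing mu (F \o shift_X (- (m * tower_height n)%N%:Z)) G) @ \oo -->
      \sum_(k < m.+1) r k * pairing mu (F \o shift_X k%:Z) G.
    move=> sF sG; set S := \sum_(k < _) _.
    rewrite (_ : (fun n => _) = (fun n => defect mu nu m n F G + S)); last first.
      by apply/funext => n; rewrite /defect subrK.
    suff : (fun n => defect mu nu m n F G + S) @ \oo --> 0 + S by rewrite add0r.
    apply: cvgD; last exact: cvg_cst.
    exact: (cvg_defect mu_chacon nu_haar m sF sG).
  by apply: cvg_complex; [apply: cvgD|apply: cvgB]; exact: cvgp.
- move=> f g /L2_csqint cf /L2_csqint cg.
  have [[fR fI] [gR gI]] := (cf, cg).
  have ck := csqint_koopman_exp mu_chacon _ cf.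
  rewrite innerE//; last exact: csqint_koopman_rho.
  have [-> ->] := koopman_rho_parts nu m f; rewrite !pS//.
  rewrite /cintegral !Rintegral_rho -big_split -sumrB.
  by congr (_ +i* _)%C; apply: eq_bigr => k _; rewrite innerE// kE /= -/(r k); ring.
Qed.
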